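(* Let $\Omega\subset\mathbb{R}^2$ be a simply connected domain and $f\in C^2(\Omega)$ a positive real valued function. Put $r_1=\Delta f/f$ and $r_2=2(\nabla f)^2/f^2-r_1$. (i) Let $W_1$ be a real valued $C^2$ solution of $-\Delta W_1+r_1W_1=0$ in $\Omega$. Then $\Psi=if^2\partial_{\bar z}(f^{-1}W_1)$ satisfies the compatibility condition of $\overline A$, and for every choice of the real constant in $\overline A$, the function $$W_2=f^{-1}\,\overline{A}\big(if^2\partial_{\bar z}(f^{-1}W_1)\big)$$ is a real valued solution of $-\Delta W_2+r_2W_2=0$ such that $W=W_1+iW_2$ solves $W_{\bar z}=\frac{f_{\bar z}}{f}\overline W$ in $\Omega$. (ii) Let $W_2$ be a real valued $C^2$ solution of $-\Delta W_2+r_2W_2=0$ in $\Omega$. Then for every choice of the real constant in $\overline A$, the function $$W_1=-f\,\overline{A}\big(if^{-2}\partial_{\bar z}(fW_2)\big)$$ is a real valued solution of $-\Delta W_1+r_1W_1=0$ such that $W=W_1+iW_2$ solves $W_{\bar z}=\frac{f_{\bar z}}{f}\overline W$ in $\Omega$.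
   Context: $\partial_{\bar z}=\frac12(\partial_x+i\partial_y)$, and $(\nabla f)^2=f_x^2+f_y^2$. For a complex function $\Psi=\Psi_1+i\Psi_2$ on a simply connected domain satisfying $\partial_y\Psi_1-\partial_x\Psi_2=0$, the operator $\overline A$ is defined by $$\overline{A}[\Psi](x,y)=2\int_\Gamma(\Psi_1\,dx+\Psi_2\,dy)+c,$$ where $\Gamma$ is any rectifiable curve in the domain from a fixed point $(x_0,y_0)$ to $(x,y)$ and $c$ is an arbitrary real constant. This integral is path independent, and $\overline A[\Psi]$ is real valued with $\partial_{\bar z}\overline A[\Psi]=\Psi$. *)

(* Defs.v *)
From Stdlib Require Import Reals.
From Coquelicot Require Import Coquelicot.
Open Scope R_scope.

Definition open2 (Om : R -> R -> Prop) : Prop :=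
  open (fun p : R * R => Om (fst p) (snd p)).

Definition cont_path (Om : R -> R -> Prop) (g : R -> R * R) : Prop :=
  (forall t, 0 <= t <= 1 -> continuous g t) /\
  (forall t, 0 <= t <= 1 -> Om (fst (g t)) (snd (g t))).

Definition path_connected2 (Om : R -> R -> Prop) : Prop :=
  forall x0 y0 x1 y1, Om x0 y0 -> Om x1 y1 ->
  exists g : R -> R * R, cont_path Om g /\ g 0 = (x0, y0) /\ g 1 = (x1, y1).

Definition loops_contractible (Om : R -> R -> Prop) : Prop :=
  forall g : R -> R * R, cont_path Om g -> g 0 = g 1 ->
  exists H : R * R -> R * R,
    (forall s t, 0 <= s <= 1 -> 0 <= t <= 1 -> continuous H (s, t)) /\
    (forall s t, 0 <= s <= 1 -> 0 <= t <= 1 ->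
        Om (fst (H (s, t))) (snd (H (s, t)))) /\
    (forall t, 0 <= t <= 1 -> H (0, t) = g t) /\
    (forall t, 0 <= t <= 1 -> H (1, t) = H (1, 0)) /\
    (forall s, 0 <= s <= 1 -> H (s, 0) = H (s, 1)).

Definition simply_connected_domain (Om : R -> R -> Prop) : Prop :=
  (exists x y, Om x y) /\ open2 Om /\ path_connected2 Om /\ loops_contractible Om.

Definition dx (u : R -> R -> R) : R -> R -> R :=
  fun x y => Derive (fun t => u t y) x.
Definition dy (u : R -> R -> R) : R -> R -> R :=
  fun x y => Derive (fun t => u x t) y.

Definition cont2 (u : R -> R -> R) (x y : R) : Prop :=
  continuous (fun p : R * R => u (fst p) (snd p)) (x, y).

Definition C1_on (Om : R -> R -> Prop) (u : R -> R -> R) : Prop :=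
  forall x y, Om x y ->
    ex_derive (fun t => u t y) x /\ ex_derive (fun t => u x t) y /\
    cont2 u x y /\ cont2 (dx u) x y /\ cont2 (dy u) x y.

Definition C2_on (Om : R -> R -> Prop) (u : R -> R -> R) : Prop :=
  C1_on Om u /\ C1_on Om (dx u) /\ C1_on Om (dy u).

Definition lap (u : R -> R -> R) : R -> R -> R :=
  fun x y => dx (dx u) x y + dy (dy u) x y.
Definition grad2 (u : R -> R -> R) : R -> R -> R :=
  fun x y => (dx u x y) ^ 2 + (dy u x y) ^ 2.

Definition ReF (W : R -> R -> C) : R -> R -> R := fun x y => Re (W x y).
Definition ImF (W : R -> R -> C) : R -> R -> R := fun x y => Im (W x y).

Definition dzbar (W : R -> R -> C) : R -> R -> C :=
  fun x y =>
    Cmult (RtoC (/ 2))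
      (Cplus ((dx (ReF W) x y, dx (ImF W) x y) : C)
             (Cmult Ci ((dy (ReF W) x y, dy (ImF W) x y) : C))).

Definition toC (u : R -> R -> R) : R -> R -> C := fun x y => RtoC (u x y).

Definition Abar_compatible (Om : R -> R -> Prop) (Psi : R -> R -> C) : Prop :=
  forall x y, Om x y -> dy (ReF Psi) x y - dx (ImF Psi) x y = 0.

(* Admissible curves for the line integral: C^1 curves
   gamma = (g1, g2) (given on all of R; only [0,1] matters) whose trace on
   [0,1] lies in Om, from (x0,y0) to (x,y). *)
Definition C1_curve (Om : R -> R -> Prop) (g1 g2 : R -> R)
  (x0 y0 x y : R) : Prop :=
  (forall t, ex_derive g1 t) /\ (forall t, ex_derive g2 t) /\
  (forall t, continuous (Derive g1) t) /\ (forall t, continuous (Derive g2) t) /\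
  (forall t, 0 <= t <= 1 -> Om (g1 t) (g2 t)) /\
  g1 0 = x0 /\ g2 0 = y0 /\ g1 1 = x /\ g2 1 = y.

Definition line_int (Psi : R -> R -> C) (g1 g2 : R -> R) : R :=
  RInt (fun t => Re (Psi (g1 t) (g2 t)) * Derive g1 t
               + Im (Psi (g1 t) (g2 t)) * Derive g2 t) 0 1.

(* U is (on Om) the function  Abar[Psi] = 2 int_Gamma (Psi_1 dx + Psi_2 dy) + c,
   with base point (x0,y0): its value at each (x,y) in Om equals this
   expression for every admissible curve Gamma from (x0,y0) to (x,y). *)
Definition is_Abar (Om : R -> R -> Prop) (Psi : R -> R -> C)
  (x0 y0 c : R) (U : R -> R -> R) : Prop :=
  forall x y g1 g2, Om x y -> C1_curve Om g1 g2 x0 y0 x y ->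
    U x y = 2 * line_int Psi g1 g2 + c.

(* Main.v *)
Require Import Defs.
From Stdlib Require Import Reals Lra Lia ClassicalEpsilon.
From Coquelicot Require Import Coquelicot.
Open Scope R_scope.

(** A closed C^1 form [P dx + Q dy] has a primitive on every square, given by integration along
    an L-shaped path. Cutting a homotopy of loops into a grid of cells, each mapped into a square
    inside the domain, shows that the integral along a contractible loop vanishes; so the form has
    a global potential, and [Abar] is twice this potential up to a constant.

    Both parts are then one computation with a nonvanishing [h] and a [w] such that
    [h lap w = w lap h]: the field [i h^2 d_zbar (w / h)] has closed components, and [V = k U / h],
    with [U] its [Abar] and [k] constant, satisfies [lap V = (2 (grad h)^2 / h^2 - lap h / h) V].
    Part (i) is [h = f], [k = 1]. Part (ii) is [h = 1 / f], [k = -1], because passing from [f] to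
    [1 / f] exchanges [r1] and [r2]. *)

(** * Local primitives of a closed form *)

(** The topological hypotheses speak of merely continuous curves, whereas [Abar] integrates along
    C^1 curves. Hence no integral is taken along an intermediate loop of a homotopy: only the images
    of grid nodes are used, joined by L-shaped paths. Conversely, [is_Abar] constrains [U] only at
    points that a C^1 curve reaches, so such curves have to be manufactured from continuous ones;
    they are made to stop at their ends, since such curves concatenate without a corner.

    The sign [k = -1] comes from multiplying by [-i]: if [W = W1 + i W2] solves the equation for
    [f], then [-i W = W2 - i W1] solves it for [1 / f], because the logarithmic derivative changes
    sign. So part (ii) is part (i) with [1 / f], [W2] and [-W1] in place of [f], [W1] and [W2]. *)

Definition square (cx cy r x y : R) : Prop := Rabs (x - cx) < r /\ Rabs (y - cy) < r.

Definition grad_on (D : R -> R -> Prop) (F P Q : R -> R -> R) : Prop :=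
  forall x y, D x y ->
    is_derive (fun t => F t y) x (P x y) /\ is_derive (fun t => F x t) y (Q x y).

Definition closed_form (Om : R -> R -> Prop) (P Q : R -> R -> R) : Prop :=
  C1_on Om P /\ C1_on Om Q /\ forall x y, Om x y -> dy P x y = dx Q x y.

(** Squares serve as neighbourhoods because they contain this path between any two of their points.
    Only end points enter, so it is available where a curve is merely continuous. *)
Definition L_int (P Q : R -> R -> R) (x y x' y' : R) : R :=
  RInt (fun t => P t y) x x' + RInt (fun t => Q x' t) y y'.

Lemma open2_square (Om : R -> R -> Prop) (x y : R) :
  open2 Om -> Om x y ->
  exists r, 0 < r /\ forall x' y', square x y r x' y' -> Om x' y'.
Proof.
intros HO Hxy.
destruct (HO (x, y) Hxy) as [r Hr].
exists r; split; [apply cond_pos|].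
intros x' y' [H1 H2].
apply (Hr (x', y')); split; assumption.
Qed.

Lemma open2_locally (Om : R -> R -> Prop) (x y : R) :
  open2 Om -> Om x y -> locally (x, y) (fun p : R * R => Om (fst p) (snd p)).
Proof. intros HO Hxy; exact (HO (x, y) Hxy). Qed.

Lemma open2_locally_x (Om : R -> R -> Prop) (x y : R) :
  open2 Om -> Om x y -> locally x (fun t => Om t y).
Proof.
intros HO Hxy.
destruct (open2_square Om x y HO Hxy) as [r [Hr H]].
exists (mkposreal r Hr); intros t Ht; apply H; split; [exact Ht|].
rewrite Rminus_eq_0, Rabs_R0; exact Hr.
Qed.

Lemma open2_locally_y (Om : R -> R -> Prop) (x y : R) :
  open2 Om -> Om x y -> locally y (fun t => Om x t).
Proof.
intros HO Hxy.
destruct (open2_square Om x y HO Hxy) as [r [Hr H]].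
exists (mkposreal r Hr); intros t Ht; apply H; split; [|exact Ht].
rewrite Rminus_eq_0, Rabs_R0; exact Hr.
Qed.

Lemma open2_of_square (cx cy r : R) : open2 (square cx cy r).
Proof.
intros [x y] [Hx Hy]; simpl in Hx, Hy.
set (d := Rmin (r - Rabs (x - cx)) (r - Rabs (y - cy))).
assert (Hd : 0 < d) by (unfold d; apply Rmin_pos; lra).
exists (mkposreal d Hd); intros [x' y'] [H1 H2]; simpl in *.
change (Rabs (x' - x) < d) in H1; change (Rabs (y' - y) < d) in H2.
assert (d <= r - Rabs (x - cx)) by apply Rmin_l.
assert (d <= r - Rabs (y - cy)) by apply Rmin_r.
split; simpl.
- replace (x' - cx) with ((x' - x) + (x - cx)) by ring.
  eapply Rle_lt_trans; [apply Rabs_triang|lra].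
- replace (y' - cy) with ((y' - y) + (y - cy)) by ring.
  eapply Rle_lt_trans; [apply Rabs_triang|lra].
Qed.

Lemma square_between_x (cx cy r x x' y t : R) :
  square cx cy r x y -> square cx cy r x' y -> Rmin x x' <= t <= Rmax x x' ->
  square cx cy r t y.
Proof.
unfold square, Rmin, Rmax; intros [H1 H2] [H3 H4] H; split; [|exact H2].
destruct (Rle_dec x x'); apply Rabs_def1; apply Rabs_def2 in H1, H3; lra.
Qed.

Lemma square_between_y (cx cy r x y y' t : R) :
  square cx cy r x y -> square cx cy r x y' -> Rmin y y' <= t <= Rmax y y' ->
  square cx cy r x t.
Proof.
unfold square, Rmin, Rmax; intros [H1 H2] [H3 H4] H; split; [exact H1|].
destruct (Rle_dec y y'); apply Rabs_def1; apply Rabs_def2 in H2, H4; lra.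
Qed.

Lemma cont2_comp (u : R -> R -> R) (g1 g2 : R -> R) (t : R) :
  cont2 u (g1 t) (g2 t) -> continuous g1 t -> continuous g2 t ->
  continuous (fun s => u (g1 s) (g2 s)) t.
Proof. intros; apply (continuous_comp_2 g1 g2 u); assumption. Qed.

Lemma cont2_x (u : R -> R -> R) (x y : R) :
  cont2 u x y -> continuous (fun t => u t y) x.
Proof.
intros H; apply (cont2_comp u (fun t => t) (fun _ => y));
  [exact H|apply continuous_id|apply continuous_const].
Qed.

Lemma cont2_y (u : R -> R -> R) (x y : R) :
  cont2 u x y -> continuous (fun t => u x t) y.
Proof.
intros H; apply (cont2_comp u (fun _ => x) (fun t => t));
  [exact H|apply continuous_const|apply continuous_id].
Qed.

(** Partial derivatives alone do not make a function differentiable; the continuity of one of them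
    on top does. Total differentiability is what the chain rule along a curve rests on. *)
Lemma grad_on_filterdiff (D : R -> R -> Prop) (F P Q : R -> R -> R) (x y : R) :
  open2 D -> grad_on D F P Q -> D x y -> cont2 P x y ->
  filterdiff (fun u : R * R => F (fst u) (snd u)) (locally (x, y))
    (fun u : R * R => plus (scal (fst u) (P x y)) (scal (snd u) (Q x y))).
Proof.
intros HO HG HD HP.
apply (is_derive_filterdiff F x y P (Q x y)); [|apply HG, HD|exact HP].
generalize (open2_locally D x y HO HD).
apply filter_imp; intros p Hp; apply HG, Hp.
Qed.

Lemma grad_on_cont2 (D : R -> R -> Prop) (F P Q : R -> R -> R) (x y : R) :
  open2 D -> grad_on D F P Q -> D x y -> cont2 P x y -> cont2 F x y.
Proof.
intros HO HG HD HP.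
apply (filterdiff_continuous (K := R_AbsRing)
  (U := prod_NormedModule R_AbsRing R_NormedModule R_NormedModule) (V := R_NormedModule)
  (fun p : R * R => F (fst p) (snd p)) (x, y)).
eexists; eapply grad_on_filterdiff; eassumption.
Qed.

Lemma grad_on_comp (D : R -> R -> Prop) (F P Q : R -> R -> R) (g1 g2 : R -> R) (t d1 d2 : R) :
  open2 D -> grad_on D F P Q -> D (g1 t) (g2 t) -> cont2 P (g1 t) (g2 t) ->
  is_derive g1 t d1 -> is_derive g2 t d2 ->
  is_derive (fun s => F (g1 s) (g2 s)) t (P (g1 t) (g2 t) * d1 + Q (g1 t) (g2 t) * d2).
Proof.
intros HO HG HD HP H1 H2.
apply is_derive_Reals, derivable_pt_lim_comp_2d; try (apply is_derive_Reals; assumption).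
apply filterdiff_differentiable_pt_lim.
eapply grad_on_filterdiff; eassumption.
Qed.

Lemma C1_on_cont (Om : R -> R -> Prop) (u : R -> R -> R) (x y : R) :
  C1_on Om u -> Om x y -> cont2 u x y.
Proof. intros H Hxy; destruct (H x y Hxy) as (_ & _ & H' & _); exact H'. Qed.

Lemma C1_on_cont_dx (Om : R -> R -> Prop) (u : R -> R -> R) (x y : R) :
  C1_on Om u -> Om x y -> cont2 (dx u) x y.
Proof. intros H Hxy; destruct (H x y Hxy) as (_ & _ & _ & H' & _); exact H'. Qed.

Lemma C1_on_cont_dy (Om : R -> R -> Prop) (u : R -> R -> R) (x y : R) :
  C1_on Om u -> Om x y -> cont2 (dy u) x y.
Proof. intros H Hxy; destruct (H x y Hxy) as (_ & _ & _ & _ & H'); exact H'. Qed.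

Lemma C1_on_grad (Om : R -> R -> Prop) (u : R -> R -> R) :
  C1_on Om u -> grad_on Om u (dx u) (dy u).
Proof.
intros H x y Hxy; destruct (H x y Hxy) as (H1 & H2 & _).
split; apply Derive_correct; assumption.
Qed.

(** In [y] only the end of the vertical leg moves, so the fundamental theorem gives [Q]. In [x] the
    horizontal leg gives [P x cy], and the vertical one, differentiated under the integral sign,
    gives the integral of [Q_x = P_y] from [cy] to [y], that is [P x y - P x cy]. *)
Lemma L_int_grad (P Q : R -> R -> R) (cx cy r : R) :
  closed_form (square cx cy r) P Q -> 0 < r ->
  grad_on (square cx cy r) (L_int P Q cx cy) P Q.
Proof.
intros (HP & HQ & Hc) Hr x y Hxy.
assert (Hcc : square cx cy r cx cy)
  by (unfold square; rewrite !Rminus_eq_0, Rabs_R0; split; exact Hr).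
assert (Hxc : forall u v, square cx cy r u v -> square cx cy r u cy)
  by (intros u v [H _]; split; [exact H|apply Hcc]).
assert (HOx := open2_locally_x _ x y (open2_of_square cx cy r) Hxy).
assert (HOy := open2_locally_y _ x y (open2_of_square cx cy r) Hxy).
assert (Qint : forall u v, square cx cy r u v -> ex_RInt (fun t => Q u t) cy v).
{ intros u v Huv; apply (ex_RInt_continuous (V := R_CompleteNormedModule)).
  intros z Hz; apply cont2_y, (C1_on_cont _ _ _ _ HQ).
  eapply square_between_y; [| |exact Hz]; [eapply Hxc|]; eassumption. }
assert (Pint : forall u v, square cx cy r u v -> ex_RInt (fun t => P t cy) cx u).
{ intros u v Huv; apply (ex_RInt_continuous (V := R_CompleteNormedModule)).
  intros z Hz; apply cont2_x, (C1_on_cont _ _ _ _ HP).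
  eapply square_between_x; [| |exact Hz]; [apply Hcc|eapply Hxc; eassumption]. }
split.
- replace (P x y) with (P x cy + (P x y - P x cy)) by ring.
  apply (is_derive_plus (K := R_AbsRing) (V := R_NormedModule)).
  + apply (is_derive_RInt (fun t => P t cy) _ cx x).
    * revert HOx; apply filter_imp; intros u Hu.
      apply (RInt_correct (V := R_CompleteNormedModule)), (Pint u y Hu).
    * apply cont2_x, (C1_on_cont _ _ _ _ HP), (Hxc x y Hxy).
  + replace (P x y - P x cy) with (RInt (fun t => Derive (fun u => Q u t) x) cy y).
    * apply (is_derive_RInt_param Q).
      -- revert HOx; apply filter_imp; intros u Hu t Ht.
         assert (Hs : square cx cy r u t)
           by (eapply square_between_y; [| |exact Ht]; [eapply Hxc|]; eassumption).
         destruct (C1_on_grad _ _ HQ u t Hs) as [HdQ _].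
         exact (ex_intro _ _ HdQ).
      -- intros t Ht; apply continuity_2d_pt_filterlim.
         apply (C1_on_cont_dx _ _ x t HQ); eapply square_between_y; [| |exact Ht]; [eapply Hxc|]; eassumption.
      -- revert HOx; apply filter_imp; intros u Hu; apply Qint, Hu.
    * transitivity (RInt (Derive (fun t => P x t)) cy y).
      -- apply RInt_ext; intros t Ht; symmetry; apply (Hc x t).
         eapply square_between_y; [| |split; apply Rlt_le, Ht]; [eapply Hxc|]; eassumption.
      -- apply RInt_Derive; intros t Ht;
         assert (Hs : square cx cy r x t)
           by (eapply square_between_y; [| |exact Ht]; [eapply Hxc|]; eassumption).
         ++ destruct (C1_on_grad _ _ HP x t Hs) as [_ HdP]; exact (ex_intro _ _ HdP).
         ++ apply (cont2_y (dy P)), (C1_on_cont_dy _ _ x t HP), Hs.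
- replace (Q x y) with (0 + Q x y) by ring.
  apply (is_derive_plus (K := R_AbsRing) (V := R_NormedModule)).
  + apply (is_derive_const (K := R_AbsRing) (V := R_NormedModule)).
  + apply (is_derive_RInt (fun t => Q x t) _ cy y).
    * revert HOy; apply filter_imp; intros u Hu.
      apply (RInt_correct (V := R_CompleteNormedModule)), (Qint x u Hu).
    * apply cont2_y, (C1_on_cont _ _ _ _ HQ), Hxy.
Qed.

Lemma L_int_primitive (P Q F : R -> R -> R) (cx cy r x y x' y' : R) :
  C1_on (square cx cy r) P -> C1_on (square cx cy r) Q ->
  grad_on (square cx cy r) F P Q ->
  square cx cy r x y -> square cx cy r x' y' ->
  L_int P Q x y x' y' = F x' y' - F x y.
Proof.
intros HP HQ HG H H'.
assert (Hm : square cx cy r x' y) by (split; [apply H'|apply H]).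
assert (Ex : RInt (fun t => P t y) x x' = F x' y - F x y).
{ apply is_RInt_unique, (is_RInt_derive (V := R_CompleteNormedModule) (fun t => F t y));
  intros t Ht; assert (Hs : square cx cy r t y)
    by (eapply square_between_x; [exact H|exact Hm|exact Ht]).
  - apply (HG t y Hs).
  - apply cont2_x, (C1_on_cont _ _ _ _ HP), Hs. }
assert (Ey : RInt (fun t => Q x' t) y y' = F x' y' - F x' y).
{ apply is_RInt_unique, (is_RInt_derive (V := R_CompleteNormedModule) (fun t => F x' t));
  intros t Ht; assert (Hs : square cx cy r x' t)
    by (eapply square_between_y; [exact Hm|exact H'|exact Ht]).
  - apply (HG x' t Hs).
  - apply cont2_y, (C1_on_cont _ _ _ _ HQ), Hs. }
unfold L_int; rewrite Ex, Ey; ring.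
Qed.

Lemma closed_form_sub (D Om : R -> R -> Prop) (P Q : R -> R -> R) :
  (forall x y, D x y -> Om x y) -> closed_form Om P Q -> closed_form D P Q.
Proof.
intros HD (HP & HQ & Hc); split; [|split]; intros x y Hxy;
  [apply HP|apply HQ|apply Hc]; auto.
Qed.

(** All three terms are increments of one function, the primitive based at the centre of the
    square. *)
Lemma L_int_chain (P Q : R -> R -> R) (cx cy r x y x' y' x'' y'' : R) :
  closed_form (square cx cy r) P Q ->
  square cx cy r x y -> square cx cy r x' y' -> square cx cy r x'' y'' ->
  L_int P Q x y x' y' + L_int P Q x' y' x'' y'' = L_int P Q x y x'' y''.
Proof.
intros HC H H' H''.
assert (Hr : 0 < r) by (eapply Rle_lt_trans; [apply Rabs_pos|apply H]).
assert (HG := L_int_grad P Q cx cy r HC Hr).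
destruct HC as (HP & HQ & _).
rewrite (L_int_primitive P Q _ cx cy r x y x' y' HP HQ HG) by assumption.
rewrite (L_int_primitive P Q _ cx cy r x' y' x'' y'' HP HQ HG) by assumption.
rewrite (L_int_primitive P Q _ cx cy r x y x'' y'' HP HQ HG) by assumption.
ring.
Qed.

(** [V] minus the primitive along the curve has derivative zero on [[a, b]]. Recording an integral
    along a curve by an antiderivative [V] avoids questions of integrability and lets pieces be
    glued by addition. *)
Lemma L_int_curve (P Q : R -> R -> R) (cx cy r : R) (g1 g2 d1 d2 V : R -> R) (a b : R) :
  closed_form (square cx cy r) P Q -> a < b ->
  (forall t, a <= t <= b ->
     square cx cy r (g1 t) (g2 t) /\ is_derive g1 t (d1 t) /\ is_derive g2 t (d2 t) /\
     is_derive V t (P (g1 t) (g2 t) * d1 t + Q (g1 t) (g2 t) * d2 t)) ->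
  L_int P Q (g1 a) (g2 a) (g1 b) (g2 b) = V b - V a.
Proof.
intros HC Hab H.
assert (Hsa : square cx cy r (g1 a) (g2 a)) by (apply H; lra).
assert (Hsb : square cx cy r (g1 b) (g2 b)) by (apply H; lra).
assert (Hr : 0 < r) by (eapply Rle_lt_trans; [apply Rabs_pos|apply Hsa]).
assert (HG := L_int_grad P Q cx cy r HC Hr).
destruct HC as (HP & HQ & _).
rewrite (L_int_primitive P Q _ cx cy r _ _ _ _ HP HQ HG) by assumption.
set (F := L_int P Q cx cy) in *.
cut (V a - F (g1 a) (g2 a) = V b - F (g1 b) (g2 b)); [lra|].
apply (eq_is_derive (V := R_NormedModule) (fun t => V t - F (g1 t) (g2 t)) a b); [|exact Hab].
intros t Ht; destruct (H t Ht) as (Hs & H1 & H2 & HV).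
match type of HV with is_derive _ _ ?l =>
  replace (@zero R_NormedModule) with (minus l l) by (unfold zero, minus, plus, opp; simpl; ring) end.
apply (is_derive_minus (K := R_AbsRing) (V := R_NormedModule)); [exact HV|].
apply (grad_on_comp (square cx cy r)); auto.
- apply open2_of_square.
- apply (C1_on_cont _ _ _ _ HP), Hs.
Qed.

(** * Vanishing of loop integrals *)

(** A Lebesgue number argument: the squares come from continuity at each point, the uniform [d] from
    compactness of the unit square. The factor 2 in [loc] leaves room for a point within [del] of
    [(u, v)] and another within [d <= del] of the first. *)
Lemma uniform_squares (Om : R -> R -> Prop) (H : R * R -> R * R) :
  open2 Om ->
  (forall s t, 0 <= s <= 1 -> 0 <= t <= 1 -> continuous H (s, t)) ->
  (forall s t, 0 <= s <= 1 -> 0 <= t <= 1 -> Om (fst (H (s, t))) (snd (H (s, t)))) ->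
  exists d, 0 < d /\ forall s t, 0 <= s <= 1 -> 0 <= t <= 1 ->
    exists cx cy r, (forall x y, square cx cy r x y -> Om x y) /\
      forall s' t', Rabs (s' - s) < d -> Rabs (t' - t) < d ->
        square cx cy r (fst (H (s', t'))) (snd (H (s', t'))).
Proof.
intros HO Hc Hin.
assert (loc : forall u v, exists del : posreal, 0 <= u <= 1 -> 0 <= v <= 1 ->
    exists cx cy r, (forall x y, square cx cy r x y -> Om x y) /\
      forall s t, Rabs (s - u) < 2 * del -> Rabs (t - v) < 2 * del ->
        square cx cy r (fst (H (s, t))) (snd (H (s, t)))).
{ intros u v.
  (* The gauge has to be a function on the whole plane; outside the unit square any positive radius
     will do. *)
  destruct (classic (0 <= u <= 1 /\ 0 <= v <= 1)) as [[Hu Hv]|Hn];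
    [|exists (mkposreal 1 Rlt_0_1); tauto].
  destruct (open2_square Om _ _ HO (Hin u v Hu Hv)) as [r [Hr Hsq]].
  destruct (proj1 (filterlim_locally _ _) (Hc u v Hu Hv) (mkposreal r Hr)) as [e He].
  assert (He2 : 0 < e / 2) by (generalize (cond_pos e); lra).
  exists (mkposreal (e / 2) He2); intros _ _.
  exists (fst (H (u, v))), (snd (H (u, v))), r; split; [exact Hsq|].
  simpl; intros s t Hs Ht.
  replace (2 * (e / 2)) with (pos e) in Hs, Ht by field.
  exact (He (s, t) (conj Hs Ht)). }
set (delta := fun u v => proj1_sig (constructive_indefinite_description _ (loc u v))).
destruct (compactness_value_2d 0 1 0 1 delta) as [d Hd].
exists d; split; [apply cond_pos|].
intros s t Hs Ht.
(* The compactness statement is doubly negated, hence the argument by contradiction. *)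
apply NNPP; intros Hn; apply (Hd s t Hs Ht); intros (u & v & Hu & Hv & H1 & H2 & H3).
apply Hn; clear Hn.
unfold delta in H1, H2, H3.
destruct (constructive_indefinite_description _ (loc u v)) as [del Hdel]; simpl in *.
destruct (Hdel Hu Hv) as (cx & cy & r & Hsq & HH).
exists cx, cy, r; split; [exact Hsq|].
intros s' t' Hs' Ht'; apply HH.
- replace (s' - u) with ((s' - s) + (s - u)) by ring.
  eapply Rle_lt_trans; [apply Rabs_triang|lra].
- replace (t' - v) with ((t' - t) + (t - v)) by ring.
  eapply Rle_lt_trans; [apply Rabs_triang|lra].
Qed.

Definition node (N i : nat) : R := INR i / INR N.

Lemma node_0 (N : nat) : node N 0 = 0.
Proof. unfold node; simpl; apply Rdiv_0_l. Qed.

Lemma node_N (N : nat) : (0 < N)%nat -> node N N = 1.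
Proof. intros HN; apply Rdiv_diag, not_0_INR; lia. Qed.

Lemma node_S (N i : nat) : (0 < N)%nat -> node N (S i) = node N i + / INR N.
Proof. intros HN; unfold node; rewrite S_INR; field; apply not_0_INR; lia. Qed.

Lemma node_lt (N i : nat) : (0 < N)%nat -> node N i < node N (S i).
Proof.
intros HN; rewrite node_S by exact HN.
assert (0 < / INR N) by (apply Rinv_0_lt_compat, lt_0_INR, HN); lra.
Qed.

Lemma node_01 (N i : nat) : (0 < N)%nat -> (i <= N)%nat -> 0 <= node N i <= 1.
Proof.
intros HN Hi; assert (H := lt_0_INR N HN); split; unfold node.
- apply Rdiv_le_0_compat; [apply pos_INR|exact H].
- apply (Rmult_le_reg_r (INR N)); [exact H|].
  replace (INR i / INR N * INR N) with (INR i) by (field; lra).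
  rewrite Rmult_1_l; apply le_INR, Hi.
Qed.

(** With mesh [/ INR N] below the uniform [d], a whole closed cell is within [d] of its lower corner
    [(node N i, node N j)]. Cells are closed because neighbours share edges and nodes. *)
Lemma fine_grid (Om : R -> R -> Prop) (H : R * R -> R * R) :
  open2 Om ->
  (forall s t, 0 <= s <= 1 -> 0 <= t <= 1 -> continuous H (s, t)) ->
  (forall s t, 0 <= s <= 1 -> 0 <= t <= 1 -> Om (fst (H (s, t))) (snd (H (s, t)))) ->
  exists N, (0 < N)%nat /\ forall i j, (i < N)%nat -> (j < N)%nat ->
    exists cx cy r, (forall x y, square cx cy r x y -> Om x y) /\
      forall s t, node N i <= s <= node N (S i) -> node N j <= t <= node N (S j) ->
        square cx cy r (fst (H (s, t))) (snd (H (s, t))).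
Proof.
intros HO Hc Hin.
destruct (uniform_squares Om H HO Hc Hin) as (d & Hd & HH).
destruct (archimed_cor1 d Hd) as (N & HN & HN0).
exists N; split; [exact HN0|]; intros i j Hi Hj.
destruct (HH (node N i) (node N j)) as (cx & cy & r & Hsq & Hcell);
  try (apply node_01; lia).
exists cx, cy, r; split; [exact Hsq|].
intros s t; rewrite !node_S by exact HN0; intros Hs Ht.
apply Hcell; apply Rabs_def1; lra.
Qed.

Lemma continuous_pair (g1 g2 : R -> R) (t : R) :
  continuous g1 t -> continuous g2 t -> continuous (fun s => (g1 s, g2 s)) t.
Proof.
intros H1 H2; apply (continuous_comp_2 g1 g2 (fun a b => (a, b)) t H1 H2).
apply (continuous_ext (fun p => p)); [intros [u v]; reflexivity|apply continuous_id].
Qed.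

Fixpoint psum (a : nat -> R) (n : nat) : R :=
  match n with O => 0 | S k => psum a k + a k end.

Lemma psum_telescope (a v : nat -> R) (n : nat) :
  (forall j, (j < n)%nat -> a j = v (S j) - v j) -> psum a n = v n - v O.
Proof.
induction n as [|n IH]; intros H; simpl; [ring|].
rewrite IH by (intros; apply H; lia).
rewrite (H n) by lia; ring.
Qed.

(** When the cells of a row are added up, each transverse edge [e] between two neighbours cancels;
    only the first and the last remain. *)
Lemma psum_rows (a b e : nat -> R) (n : nat) :
  (forall j, (j < n)%nat -> a j + e (S j) = e j + b j) ->
  psum a n + e n = e O + psum b n.
Proof.
induction n as [|n IH]; intros H; simpl; [ring|].
assert (IH' := IH (fun j Hj => H j (Nat.lt_trans _ _ _ Hj (Nat.lt_succ_diag_r n)))).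
assert (Hn := H n (Nat.lt_succ_diag_r n)); lra.
Qed.

(* Across one cell of the grid both ways round the boundary give the same increment,
   so the discretised integral over a row of the homotopy does not depend on the row. *)
Lemma loop_increment (Om : R -> R -> Prop) (P Q : R -> R -> R) (g1 g2 d1 d2 V : R -> R) :
  open2 Om -> loops_contractible Om -> closed_form Om P Q ->
  (forall t, 0 <= t <= 1 ->
     Om (g1 t) (g2 t) /\ is_derive g1 t (d1 t) /\ is_derive g2 t (d2 t) /\
     is_derive V t (P (g1 t) (g2 t) * d1 t + Q (g1 t) (g2 t) * d2 t)) ->
  g1 0 = g1 1 -> g2 0 = g2 1 -> V 0 = V 1.
Proof.
intros HO HL HC Hg E1 E2.
destruct (HL (fun t => (g1 t, g2 t))) as (H & Hc & Hin & H0 & H1 & Hs).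
{ split; intros t Ht; destruct (Hg t Ht) as (HOm & Hd1 & Hd2 & _); [|exact HOm].
  apply continuous_pair;
    [apply (ex_derive_continuous g1 t (ex_intro _ _ Hd1))
    |apply (ex_derive_continuous g2 t (ex_intro _ _ Hd2))]. }
{ rewrite E1, E2; reflexivity. }
destruct (fine_grid Om H HO Hc Hin) as (N & HN & Hcell).
set (h1 := fun i j => fst (H (node N i, node N j))).
set (h2 := fun i j => snd (H (node N i, node N j))).
set (row := fun i j => L_int P Q (h1 i j) (h2 i j) (h1 i (S j)) (h2 i (S j))).
set (col := fun i j => L_int P Q (h1 i j) (h2 i j) (h1 (S i) j) (h2 (S i) j)).
assert (Hrow : forall i, (i < N)%nat -> psum (row i) N = psum (row (S i)) N).
{ intros i Hi.
  (* Each stage of the homotopy is a closed curve, so the transverse edges at the two ends of the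
     row coincide and cancel. *)
  assert (Hcol : col i N = col i O).
  { unfold col, h1, h2; rewrite node_0, node_N by exact HN.
    rewrite <- !Hs by (apply node_01; lia); reflexivity. }
  cut (psum (row i) N + col i N = col i O + psum (row (S i)) N); [lra|].
  apply psum_rows; intros j Hj.
  destruct (Hcell i j Hi Hj) as (cx & cy & r & Hsq & HH).
  assert (HCs := closed_form_sub _ Om P Q Hsq HC).
  assert (Li := node_lt N i HN); assert (Lj := node_lt N j HN).
  unfold row, col, h1, h2.
  rewrite !(L_int_chain P Q cx cy r) by (try exact HCs; apply HH; lra).
  reflexivity. }
assert (Hall : forall i, (i <= N)%nat -> psum (row O) N = psum (row i) N).
{ induction i as [|i IH]; intros Hi; [reflexivity|].
  rewrite IH by lia; apply Hrow; lia. }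
(* The last stage is a single point, so every L-shaped integral runs between equal points. *)
assert (Hlast : psum (row N) N = 0).
{ rewrite (psum_telescope _ (fun _ => 0)); [ring|].
  intros j Hj; unfold row, h1, h2; rewrite node_N by exact HN.
  rewrite (H1 (node N j)) by (apply node_01; lia).
  rewrite (H1 (node N (S j))) by (apply node_01; lia).
  unfold L_int; rewrite !RInt_point; unfold zero; simpl; ring. }
(* Stage 0 is the only one known to be differentiable, and the only one where the sum is compared
   with [V]. *)
assert (Hfirst : psum (row O) N = V 1 - V 0).
{ rewrite (psum_telescope _ (fun j => V (node N j))); [now rewrite node_0, node_N|].
  intros j Hj; unfold row, h1, h2.
  destruct (Hcell O j HN Hj) as (cx & cy & r & Hsq & HH).
  assert (Lj := node_lt N j HN); assert (Li := node_lt N 0 HN).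
  assert (B0 : 0 <= node N j <= 1) by (apply node_01; lia).
  assert (B1 : 0 <= node N (S j) <= 1) by (apply node_01; lia).
  rewrite node_0 in HH, Li |- *; rewrite !H0 by assumption; simpl.
  apply (L_int_curve P Q cx cy r g1 g2 d1 d2);
    [exact (closed_form_sub _ Om P Q Hsq HC)|exact Lj|].
  intros t Ht; assert (Ht1 : 0 <= t <= 1) by lra.
  split; [|apply (Hg t Ht1)].
  generalize (HH 0 t); rewrite H0 by exact Ht1; simpl; intros HH'; apply HH'; lra. }
rewrite (Hall N), Hlast in Hfirst by lia; lra.
Qed.

(** * The global potential *)

(** The building block of a C^1 spline. At the break point the difference quotient is [h] or [0], so
    both one-sided derivatives vanish. *)
Lemma is_derive_sqr_pos_part (t : R) :
  is_derive (fun s => Rmax 0 s ^ 2) t (2 * Rmax 0 t).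
Proof.
destruct (Rtotal_order t 0) as [Ht|[Ht|Ht]].
- apply (is_derive_ext_loc (fun _ => 0)).
  + assert (Hn : 0 < - t) by lra.
    exists (mkposreal _ Hn); intros s Hs; apply Rabs_def2 in Hs; simpl in Hs.
    unfold minus, plus, opp in Hs; simpl in Hs.
    rewrite Rmax_left by lra; change (0 = 0 ^ 2 :> R); ring.
  + rewrite Rmax_left, Rmult_0_r by lra.
    apply (is_derive_const (K := R_AbsRing) (V := R_NormedModule)).
- subst t; rewrite Rmax_left, Rmult_0_r by lra.
  apply is_derive_Reals; intros eps Heps.
  exists (mkposreal eps Heps); intros h Hh0 Hh; simpl in Hh.
  rewrite Rplus_0_l, (Rmax_left 0 0) by lra.
  replace ((Rmax 0 h ^ 2 - 0 ^ 2) / h - 0) with (Rmax 0 h ^ 2 / h) by (field; exact Hh0).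
  unfold Rmax; destruct (Rle_dec 0 h).
  + replace (h ^ 2 / h) with h by (field; exact Hh0); exact Hh.
  + replace (0 ^ 2 / h) with 0 by (field; exact Hh0); rewrite Rabs_R0; exact Heps.
- apply (is_derive_ext_loc (fun s => s ^ 2)).
  + exists (mkposreal _ Ht); intros s Hs; apply Rabs_def2 in Hs; simpl in Hs.
    unfold minus, plus, opp in Hs; simpl in Hs.
    rewrite Rmax_right by lra; reflexivity.
  + rewrite Rmax_right by lra; auto_derive; [trivial|ring].
Qed.

Lemma is_derive_affine (f : R -> R) (a b t l : R) :
  is_derive f (a * t + b) l -> is_derive (fun s => f (a * s + b)) t (a * l).
Proof.
intros H; apply (is_derive_comp (K := R_AbsRing) (V := R_NormedModule) f); [exact H|].
auto_derive; [trivial|ring].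
Qed.

Lemma continuous_affine (f : R -> R) (a b t : R) :
  continuous f (a * t + b) -> continuous (fun s => f (a * s + b)) t.
Proof.
intros H; apply (continuous_comp (fun s => a * s + b) f); [|exact H].
apply (ex_derive_continuous (fun s => a * s + b)); auto_derive; trivial.
Qed.

(** The witness is the quadratic spline with knots 0, 1/2 and 1: [2 t^2], then [1 - 2 (1 - t)^2].
    The weights 2, -4, 2 form a second difference, so beyond 1 the quadratic and linear terms cancel
    and the constant 1 is left. It serves to run through a segment starting and ending at rest. *)
Lemma smooth_step_exists :
  exists s ds : R -> R,
    (forall t, is_derive s t (ds t) /\ continuous ds t /\ 0 <= s t <= 1) /\
    (forall t, t <= 0 -> s t = 0 /\ ds t = 0) /\
    (forall t, 1 <= t -> s t = 1 /\ ds t = 0).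
Proof.
set (q := fun t => Rmax 0 t ^ 2).
exists (fun t => 2 * q (1 * t + 0) + (-4 * q (1 * t + - / 2) + 2 * q (1 * t + - 1))).
exists (fun t => 2 * (1 * (2 * Rmax 0 (1 * t + 0)))
  + (-4 * (1 * (2 * Rmax 0 (1 * t + - / 2))) + 2 * (1 * (2 * Rmax 0 (1 * t + - 1))))).
split; [|split].
- intros t; split; [|split].
  + repeat apply (is_derive_plus (K := R_AbsRing) (V := R_NormedModule));
    apply is_derive_scal, is_derive_affine, is_derive_sqr_pos_part.
  + assert (Hm : forall k c, continuous (fun s => k * (1 * (2 * Rmax 0 (1 * s + c)))) t).
    { intros k c; apply (continuous_scal_r k (fun s => 1 * (2 * Rmax 0 (1 * s + c)))).
      apply (continuous_scal_r 1 (fun s => 2 * Rmax 0 (1 * s + c))).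
      apply (continuous_scal_r 2 (fun s => Rmax 0 (1 * s + c))).
      apply (continuous_affine (Rmax 0)).
      apply (continuous_ext (fun u => / 2 * (u + Rabs u))).
      - intros u; unfold Rabs, Rmax.
        destruct (Rcase_abs u); destruct (Rle_dec 0 u); lra.
      - apply (continuous_scal_r (/ 2) (fun u => u + Rabs u)).
        apply (continuous_plus (V := R_NormedModule) (fun u => u) Rabs);
          [apply continuous_id|apply continuous_Rabs]. }
    apply (continuous_plus (V := R_NormedModule) _ _ t (Hm 2 0)).
    exact (continuous_plus (V := R_NormedModule) _ _ t (Hm (-4) (- / 2)) (Hm 2 (- 1))).
  + unfold q, Rmax; repeat destruct Rle_dec; split; nra.
- intros t Ht; unfold q; rewrite !Rmax_left by lra; split; ring.
- intros t Ht; unfold q; rewrite !Rmax_right by lra; split; field.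
Qed.

(* [v] is the integral of [P dx + Q dy] along a C^1 curve in [Om] from [(x0, y0)] to [(x, y)];
   the curve rests at its end points outside [0, 1], so that concatenations stay C^1. *)
Definition reach (Om : R -> R -> Prop) (P Q : R -> R -> R) (x0 y0 x y v : R) : Prop :=
  exists g1 g2 d1 d2 V : R -> R,
    (forall t, Om (g1 t) (g2 t) /\ is_derive g1 t (d1 t) /\ is_derive g2 t (d2 t) /\
       continuous d1 t /\ continuous d2 t /\
       is_derive V t (P (g1 t) (g2 t) * d1 t + Q (g1 t) (g2 t) * d2 t)) /\
    (forall t, t <= 0 -> g1 t = x0 /\ g2 t = y0 /\ d1 t = 0 /\ d2 t = 0 /\ V t = 0) /\
    (forall t, 1 <= t -> g1 t = x /\ g2 t = y /\ d1 t = 0 /\ d2 t = 0 /\ V t = v).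

Lemma reach_C1_curve (Om : R -> R -> Prop) (P Q : R -> R -> R) (x0 y0 x y v : R) :
  reach Om P Q x0 y0 x y v -> exists g1 g2, C1_curve Om g1 g2 x0 y0 x y.
Proof.
intros (g1 & g2 & d1 & d2 & V & Hg & H0 & H1).
exists g1, g2.
destruct (H0 0 (Rle_refl 0)) as (E1 & E2 & _); destruct (H1 1 (Rle_refl 1)) as (E3 & E4 & _).
repeat split; try assumption.
- intros t; exists (d1 t); apply Hg.
- intros t; exists (d2 t); apply Hg.
- intros t; apply (continuous_ext d1); [|apply Hg].
  intros u; symmetry; apply is_derive_unique, Hg.
- intros t; apply (continuous_ext d2); [|apply Hg].
  intros u; symmetry; apply is_derive_unique, Hg.
- intros t _; apply Hg.
Qed.

Lemma reach_refl (Om : R -> R -> Prop) (P Q : R -> R -> R) (x0 y0 : R) :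
  Om x0 y0 -> reach Om P Q x0 y0 x0 y0 0.
Proof.
intros H.
exists (fun _ => x0), (fun _ => y0), (fun _ => 0), (fun _ => 0), (fun _ => 0).
split; [|split; intros; repeat split; reflexivity].
intros t.
replace (P x0 y0 * 0 + Q x0 y0 * 0) with 0 by ring.
assert (Hd : forall c, is_derive (fun _ : R => c) t 0)
  by (intros c; apply (is_derive_const (K := R_AbsRing) (V := R_NormedModule))).
exact (conj H (conj (Hd x0) (conj (Hd y0)
  (conj (continuous_const 0 t) (conj (continuous_const 0 t) (Hd 0)))))).
Qed.

(* Since both curves rest outside [0, 1], the loop [a] followed by the reverse of [b]
   is the C^1 curve [t |-> a (2 t) + b (2 - 2 t) - (x, y)]. *)
Lemma reach_unique (Om : R -> R -> Prop) (P Q : R -> R -> R) (x0 y0 x y v w : R) :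
  open2 Om -> loops_contractible Om -> closed_form Om P Q ->
  reach Om P Q x0 y0 x y v -> reach Om P Q x0 y0 x y w -> v = w.
Proof.
intros HO HL HC (a1 & a2 & da1 & da2 & A & Ha & Ha0 & Ha1)
  (b1 & b2 & db1 & db2 & B & Hb & Hb0 & Hb1).
set (g1 := fun t => a1 (2 * t + 0) + (b1 (-2 * t + 2) - x)).
set (g2 := fun t => a2 (2 * t + 0) + (b2 (-2 * t + 2) - y)).
(* Running [b] backwards contributes [B (2 - 2 t)], so [V 0 = A 0 + B 2 = w] and
   [V 1 = A 2 + B 0 = v]. *)
set (V := fun t => A (2 * t + 0) + B (-2 * t + 2)).
assert (Hlin : forall (f h : R -> R) t l m, is_derive f (2 * t + 0) l -> is_derive h (-2 * t + 2) m ->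
  is_derive (fun s => f (2 * s + 0) + h (-2 * s + 2)) t (2 * l + -2 * m)).
{ intros f h t l m Hf Hh.
  apply (is_derive_plus (K := R_AbsRing) (V := R_NormedModule)
    (fun s => f (2 * s + 0)) (fun s => h (-2 * s + 2))); apply is_derive_affine; assumption. }
assert (Hlin' : forall (f h : R -> R) z t l m, is_derive f (2 * t + 0) l -> is_derive h (-2 * t + 2) m ->
  is_derive (fun s => f (2 * s + 0) + (h (-2 * s + 2) - z)) t (2 * l + -2 * m)).
{ intros f h z t l m Hf Hh.
  apply (Hlin f (fun u => h u - z)); [exact Hf|].
  replace m with (minus m 0) by (unfold minus, plus, opp; simpl; ring).
  apply (is_derive_minus (K := R_AbsRing) (V := R_NormedModule)); [exact Hh|].
  apply (is_derive_const (K := R_AbsRing) (V := R_NormedModule)). }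
assert (HV : V 0 = V 1).
{ apply (loop_increment Om P Q g1 g2 (fun t => 2 * da1 (2 * t + 0) + -2 * db1 (-2 * t + 2))
    (fun t => 2 * da2 (2 * t + 0) + -2 * db2 (-2 * t + 2)) V HO HL HC).
  - intros t _.
    destruct (Ha (2 * t + 0)) as (HaO & HA1 & HA2 & _ & _ & HA).
    destruct (Hb (-2 * t + 2)) as (HbO & HB1 & HB2 & _ & _ & HB).
    assert (HD := Hlin A B t _ _ HA HB).
    split; [|split; [apply Hlin'; assumption|split; [apply Hlin'; assumption|]]].
    + unfold g1, g2; destruct (Rle_dec (2 * t) 1).
      * destruct (Hb1 (-2 * t + 2)) as (-> & -> & _); [lra|].
        replace (a1 (2 * t + 0) + (x - x)) with (a1 (2 * t + 0)) by ring.
        replace (a2 (2 * t + 0) + (y - y)) with (a2 (2 * t + 0)) by ring.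
        exact HaO.
      * destruct (Ha1 (2 * t + 0)) as (-> & -> & _); [lra|].
        replace (x + (b1 (-2 * t + 2) - x)) with (b1 (-2 * t + 2)) by ring.
        replace (y + (b2 (-2 * t + 2) - y)) with (b2 (-2 * t + 2)) by ring.
        exact HbO.
    + match type of HD with is_derive _ _ ?l =>
        match goal with |- is_derive _ _ ?r => replace r with l; [exact HD|] end end.
      unfold g1, g2; destruct (Rle_dec (2 * t) 1).
      * destruct (Hb1 (-2 * t + 2)) as (-> & -> & -> & -> & _); [lra|].
        replace (a1 (2 * t + 0) + (x - x)) with (a1 (2 * t + 0)) by ring.
        replace (a2 (2 * t + 0) + (y - y)) with (a2 (2 * t + 0)) by ring.
        ring.
      * destruct (Ha1 (2 * t + 0)) as (-> & -> & -> & -> & _); [lra|].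
        replace (x + (b1 (-2 * t + 2) - x)) with (b1 (-2 * t + 2)) by ring.
        replace (y + (b2 (-2 * t + 2) - y)) with (b2 (-2 * t + 2)) by ring.
        ring.
  - unfold g1.
    destruct (Ha0 (2 * 0 + 0)) as (-> & _); [lra|]; destruct (Ha1 (2 * 1 + 0)) as (-> & _); [lra|].
    destruct (Hb1 (-2 * 0 + 2)) as (-> & _); [lra|]; destruct (Hb0 (-2 * 1 + 2)) as (-> & _); [lra|].
    ring.
  - unfold g2.
    destruct (Ha0 (2 * 0 + 0)) as (_ & -> & _); [lra|]; destruct (Ha1 (2 * 1 + 0)) as (_ & -> & _); [lra|].
    destruct (Hb1 (-2 * 0 + 2)) as (_ & -> & _); [lra|]; destruct (Hb0 (-2 * 1 + 2)) as (_ & -> & _); [lra|].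
    ring. }
unfold V in HV.
destruct (Ha0 (2 * 0 + 0)) as (_ & _ & _ & _ & EA0); [lra|].
destruct (Ha1 (2 * 1 + 0)) as (_ & _ & _ & _ & EA1); [lra|].
destruct (Hb1 (-2 * 0 + 2)) as (_ & _ & _ & _ & EB1); [lra|].
destruct (Hb0 (-2 * 1 + 2)) as (_ & _ & _ & _ & EB0); [lra|].
lra.
Qed.

Lemma square_convex (cx cy r x y x' y' s : R) :
  square cx cy r x y -> square cx cy r x' y' -> 0 <= s <= 1 ->
  square cx cy r (x + (x' - x) * s) (y + (y' - y) * s).
Proof.
assert (Hcv : forall u u', Rabs u < r -> Rabs u' < r -> 0 <= s <= 1 ->
  Rabs (u + (u' - u) * s) < r).
{ intros u u' Hu Hu' Hs.
  apply Rle_lt_trans with (Rmax (Rabs u) (Rabs u')); [|apply Rmax_lub_lt; assumption].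
  assert (H1 := Rmax_l (Rabs u) (Rabs u')); assert (H2 := Rmax_r (Rabs u) (Rabs u')).
  set (m := Rmax (Rabs u) (Rabs u')) in *.
  apply Rabs_le_between in H1, H2; apply Rabs_le_between; nra. }
intros [H1 H2] [H3 H4] Hs; split.
- replace (x + (x' - x) * s - cx) with (x - cx + (x' - cx - (x - cx)) * s) by ring; auto.
- replace (y + (y' - y) * s - cy) with (y - cy + (y' - cy - (y - cy)) * s) by ring; auto.
Qed.

(** The curve is prolonged by the straight segment, run with the smooth step, and not by the
    L-shaped path, which has a corner. Both give the same increment of the local primitive [F]. *)
Lemma reach_step (Om : R -> R -> Prop) (P Q : R -> R -> R) (x0 y0 x y x' y' v cx cy r : R) :
  closed_form Om P Q -> (forall a b, square cx cy r a b -> Om a b) ->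
  square cx cy r x y -> square cx cy r x' y' ->
  reach Om P Q x0 y0 x y v ->
  reach Om P Q x0 y0 x' y' (v + L_int P Q x y x' y').
Proof.
intros HC Hsq Hp Hp' (a1 & a2 & da1 & da2 & A & Ha & Ha0 & Ha1).
destruct smooth_step_exists as (s & ds & Hs & Hs0 & Hs1).
assert (HCs := closed_form_sub _ Om P Q Hsq HC).
assert (Hr : 0 < r) by (eapply Rle_lt_trans; [apply Rabs_pos|apply Hp]).
assert (HG := L_int_grad P Q cx cy r HCs Hr).
destruct HCs as (HP & HQ & _).
rewrite (L_int_primitive P Q _ cx cy r x y x' y' HP HQ HG Hp Hp').
set (F := L_int P Q cx cy) in *.
set (e1 := fun t => x + (x' - x) * s t); set (e2 := fun t => y + (y' - y) * s t).
assert (He : forall t, square cx cy r (e1 t) (e2 t))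
  by (intros t; apply square_convex; [exact Hp|exact Hp'|apply Hs]).
assert (Hde : forall p k t, is_derive (fun t => p + k * s t) t (k * ds t)).
{ intros p k t; replace (k * ds t) with (plus 0 (k * ds t)) by (unfold plus; simpl; ring).
  apply (is_derive_plus (K := R_AbsRing) (V := R_NormedModule) (fun _ => p) (fun t => k * s t)).
  - apply (is_derive_const (K := R_AbsRing) (V := R_NormedModule)).
  - apply is_derive_scal, Hs. }
assert (HdF : forall t, is_derive (fun t => F (e1 t) (e2 t)) t
  (P (e1 t) (e2 t) * ((x' - x) * ds t) + Q (e1 t) (e2 t) * ((y' - y) * ds t))).
{ intros t; apply (grad_on_comp (square cx cy r)); auto.
  - apply open2_of_square.
  - apply (C1_on_cont _ _ _ _ HP), He.
  - apply Hde.
  - apply Hde. }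
assert (Hsum : forall (f h : R -> R) z t l m, is_derive f (2 * t + 0) l ->
  is_derive h (2 * t + -1) m ->
  is_derive (fun s => f (2 * s + 0) + (h (2 * s + -1) - z)) t (2 * l + 2 * m)).
{ intros f h z t l m Hf Hh.
  apply (is_derive_plus (K := R_AbsRing) (V := R_NormedModule)
    (fun s => f (2 * s + 0)) (fun s => h (2 * s + -1) - z)); [apply is_derive_affine; exact Hf|].
  replace (2 * m) with (minus (2 * m) 0) by (unfold minus, plus, opp; simpl; ring).
  apply (is_derive_minus (K := R_AbsRing) (V := R_NormedModule) (fun s => h (2 * s + -1)));
    [apply is_derive_affine; exact Hh|].
  apply (is_derive_const (K := R_AbsRing) (V := R_NormedModule)). }
assert (Hcs : forall d k t, continuous d (2 * t + 0) ->
  continuous (fun t => 2 * d (2 * t + 0) + 2 * (k * ds (2 * t + -1))) t).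
{ intros d k t Hd.
  apply (continuous_plus (V := R_NormedModule) (fun t => 2 * d (2 * t + 0))
    (fun t => 2 * (k * ds (2 * t + -1)))).
  - apply (continuous_scal_r 2 (fun t => d (2 * t + 0))), continuous_affine, Hd.
  - apply (continuous_scal_r 2 (fun t => k * ds (2 * t + -1))).
    apply (continuous_scal_r k (fun t => ds (2 * t + -1))), continuous_affine, Hs. }
(* During the first half of the time the segment rests at [(x, y)], during the second half the old
   curve does; one of the two summands is always neutral, which replaces a definition by cases. *)
exists (fun t => a1 (2 * t + 0) + (e1 (2 * t + -1) - x)).
exists (fun t => a2 (2 * t + 0) + (e2 (2 * t + -1) - y)).
exists (fun t => 2 * da1 (2 * t + 0) + 2 * ((x' - x) * ds (2 * t + -1))).
exists (fun t => 2 * da2 (2 * t + 0) + 2 * ((y' - y) * ds (2 * t + -1))).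
exists (fun t => A (2 * t + 0) + (F (e1 (2 * t + -1)) (e2 (2 * t + -1)) - F x y)).
split; [|split].
- intros t.
  destruct (Ha (2 * t + 0)) as (HaO & HA1 & HA2 & HcA1 & HcA2 & HA).
  assert (HD := Hsum A (fun t => F (e1 t) (e2 t)) (F x y) t _ _ HA (HdF (2 * t + -1))).
  split; [|split; [|split; [|split; [|split]]]].
  + destruct (Rle_dec (2 * t) 1).
    * unfold e1, e2; destruct (Hs0 (2 * t + -1)) as (-> & _); [lra|].
      replace (a1 (2 * t + 0) + (x + (x' - x) * 0 - x)) with (a1 (2 * t + 0)) by ring.
      replace (a2 (2 * t + 0) + (y + (y' - y) * 0 - y)) with (a2 (2 * t + 0)) by ring.
      exact HaO.
    * destruct (Ha1 (2 * t + 0)) as (-> & -> & _); [lra|].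
      replace (x + (e1 (2 * t + -1) - x)) with (e1 (2 * t + -1)) by ring.
      replace (y + (e2 (2 * t + -1) - y)) with (e2 (2 * t + -1)) by ring.
      apply Hsq, He.
  + apply Hsum; [exact HA1|apply Hde].
  + apply Hsum; [exact HA2|apply Hde].
  + apply Hcs, HcA1.
  + apply Hcs, HcA2.
  + match type of HD with is_derive _ _ ?l =>
      match goal with |- is_derive _ _ ?r => replace r with l; [exact HD|] end end.
    destruct (Rle_dec (2 * t) 1).
    * unfold e1, e2; destruct (Hs0 (2 * t + -1)) as (-> & ->); [lra|].
      replace (a1 (2 * t + 0) + (x + (x' - x) * 0 - x)) with (a1 (2 * t + 0)) by ring.
      replace (a2 (2 * t + 0) + (y + (y' - y) * 0 - y)) with (a2 (2 * t + 0)) by ring.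
      ring.
    * destruct (Ha1 (2 * t + 0)) as (-> & -> & -> & -> & _); [lra|].
      replace (x + (e1 (2 * t + -1) - x)) with (e1 (2 * t + -1)) by ring.
      replace (y + (e2 (2 * t + -1) - y)) with (e2 (2 * t + -1)) by ring.
      ring.
- intros t Ht.
  destruct (Ha0 (2 * t + 0)) as (-> & -> & -> & -> & ->); [lra|].
  unfold e1, e2; destruct (Hs0 (2 * t + -1)) as (-> & ->); [lra|].
  replace (x + (x' - x) * 0) with x by ring; replace (y + (y' - y) * 0) with y by ring.
  repeat split; ring.
- intros t Ht.
  destruct (Ha1 (2 * t + 0)) as (-> & -> & -> & -> & ->); [lra|].
  unfold e1, e2; destruct (Hs1 (2 * t + -1)) as (-> & ->); [lra|].
  replace (x + (x' - x) * 1) with x' by ring; replace (y + (y' - y) * 1) with y' by ring.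
  repeat split; ring.
Qed.

(** A continuous path is covered by finitely many squares in the domain; from node to node
    [reach_step] replaces it by segments. *)
Lemma reach_exists (Om : R -> R -> Prop) (P Q : R -> R -> R) (x0 y0 x y : R) :
  open2 Om -> path_connected2 Om -> closed_form Om P Q ->
  Om x0 y0 -> Om x y -> exists v, reach Om P Q x0 y0 x y v.
Proof.
intros HO Hpc HC H0 H1.
destruct (Hpc x0 y0 x y H0 H1) as (g & [Hgc HgO] & E0 & E1).
(* The path is taken as a homotopy that does not depend on its first variable; the cells with first
   index 0 then subdivide it. *)
destruct (fine_grid Om (fun p => g (snd p)) HO) as (N & HN & Hcell).
{ intros s t _ Ht; apply (continuous_comp snd g); [apply continuous_snd|apply Hgc, Ht]. }
{ intros s t _ Ht; apply HgO, Ht. }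
assert (Hind : forall j, (j <= N)%nat ->
  exists v, reach Om P Q x0 y0 (fst (g (node N j))) (snd (g (node N j))) v).
{ induction j as [|j IH]; intros Hj.
  - exists 0; rewrite node_0, E0; apply reach_refl, H0.
  - destruct IH as [v Hv]; [lia|].
    destruct (Hcell O j HN) as (cx & cy & r & Hsq & HH); [lia|].
    assert (Lj := node_lt N j HN); assert (Li := node_lt N 0 HN).
    eexists; eapply reach_step; [exact HC|exact Hsq| | |exact Hv];
      [apply (HH (node N 0) (node N j))|apply (HH (node N 0) (node N (S j)))]; lra. }
destruct (Hind N (Nat.le_refl N)) as [v Hv].
rewrite node_N, E1 in Hv by exact HN; exists v; exact Hv.
Qed.

(** Prolonging a curve by one step inside a square changes its value by [L_int]. As the value is
    unique, the potential near a point is a constant plus the local primitive, and inherits its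
    gradient. *)
Lemma potential_exists (Om : R -> R -> Prop) (P Q : R -> R -> R) :
  simply_connected_domain Om -> closed_form Om P Q -> exists F, grad_on Om F P Q.
Proof.
intros ((x0 & y0 & H0) & HO & Hpc & HL) HC.
(* Some value of the integral is chosen by [epsilon]; [reach_unique] shows below that the choice
   does not matter. *)
set (F := fun x y => epsilon (inhabits 0) (reach Om P Q x0 y0 x y)).
assert (HF : forall x y, Om x y -> reach Om P Q x0 y0 x y (F x y)).
{ intros x y Hxy; apply epsilon_spec, reach_exists; assumption. }
exists F; intros x y Hxy.
destruct (open2_square Om x y HO Hxy) as (r & Hr & Hsq).
assert (Hc : square x y r x y)
  by (unfold square; rewrite !Rminus_eq_0, Rabs_R0; split; exact Hr).
assert (HCs := closed_form_sub _ Om P Q Hsq HC).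
assert (Hloc : forall u v, square x y r u v -> F x y + L_int P Q x y u v = F u v).
{ intros u v Huv; apply (reach_unique Om P Q x0 y0 u v); try assumption.
  - apply (reach_step _ _ _ _ _ x y _ _ _ x y r); auto.
  - apply HF, Hsq, Huv. }
destruct (L_int_grad P Q x y r HCs Hr x y Hc) as [Hx Hy].
assert (Hplus : forall (f : R -> R) t l, is_derive f t l -> is_derive (fun s => F x y + f s) t l).
{ intros f t l Hf; replace l with (plus 0 l) by (unfold plus; simpl; ring).
  apply (is_derive_plus (K := R_AbsRing) (V := R_NormedModule) (fun _ => F x y) f); [|exact Hf].
  apply (is_derive_const (K := R_AbsRing) (V := R_NormedModule)). }
split.
- apply (is_derive_ext_loc (fun t => F x y + L_int P Q x y t y)); [|apply Hplus, Hx].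
  generalize (open2_locally_x _ x y (open2_of_square x y r) Hc); apply filter_imp.
  intros t Ht; apply Hloc, Ht.
- apply (is_derive_ext_loc (fun t => F x y + L_int P Q x y x t)); [|apply Hplus, Hy].
  generalize (open2_locally_y _ x y (open2_of_square x y r) Hc); apply filter_imp.
  intros t Ht; apply Hloc, Ht.
Qed.

Lemma line_int_potential (Om : R -> R -> Prop) (Psi : R -> R -> C) (F : R -> R -> R)
  (g1 g2 : R -> R) (x0 y0 x y : R) :
  open2 Om -> C1_on Om (ReF Psi) -> C1_on Om (ImF Psi) -> grad_on Om F (ReF Psi) (ImF Psi) ->
  C1_curve Om g1 g2 x0 y0 x y -> line_int Psi g1 g2 = F x y - F x0 y0.
Proof.
intros HO HP HQ HG (H1 & H2 & C1 & C2 & Hin & <- & <- & <- & <-).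
apply is_RInt_unique.
apply (is_RInt_derive (V := R_CompleteNormedModule) (fun t => F (g1 t) (g2 t)));
  rewrite Rmin_left, Rmax_right by lra; intros t Ht.
- apply (grad_on_comp Om F (ReF Psi) (ImF Psi)); auto.
  + apply (C1_on_cont _ _ _ _ HP); auto.
  + apply Derive_correct, H1.
  + apply Derive_correct, H2.
- assert (Hc1 := ex_derive_continuous g1 t (H1 t)).
  assert (Hc2 := ex_derive_continuous g2 t (H2 t)).
  apply (continuous_plus (V := R_NormedModule)
    (fun t => ReF Psi (g1 t) (g2 t) * Derive g1 t) (fun t => ImF Psi (g1 t) (g2 t) * Derive g2 t)).
  + apply (continuous_mult (K := R_AbsRing) (fun t => ReF Psi (g1 t) (g2 t)) (Derive g1)); [|apply C1].
    apply cont2_comp; auto; apply (C1_on_cont _ _ _ _ HP); auto.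
  + apply (continuous_mult (K := R_AbsRing) (fun t => ImF Psi (g1 t) (g2 t)) (Derive g2)); [|apply C2].
    apply cont2_comp; auto; apply (C1_on_cont _ _ _ _ HQ); auto.
Qed.

Lemma is_derive_2_minus (F : R -> R) (k c t l : R) :
  is_derive F t l -> is_derive (fun s => 2 * (F s - k) + c) t (2 * l).
Proof.
intros H; apply (is_derive_ext (fun s => 2 * F s + (c - 2 * k))).
- intros s; change (2 * F s + (c - 2 * k) = 2 * (F s - k) + c :> R); ring.
- replace (2 * l) with (plus (2 * l) 0) by (unfold plus; simpl; ring).
  apply (is_derive_plus (K := R_AbsRing) (V := R_NormedModule) (fun s => 2 * F s)).
  + apply is_derive_scal, H.
  + apply (is_derive_const (K := R_AbsRing) (V := R_NormedModule)).
Qed.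

Lemma is_Abar_exists (Om : R -> R -> Prop) (Psi : R -> R -> C) (x0 y0 c : R) :
  simply_connected_domain Om -> closed_form Om (ReF Psi) (ImF Psi) ->
  exists U, is_Abar Om Psi x0 y0 c U.
Proof.
intros Hsc HC.
destruct (potential_exists Om _ _ Hsc HC) as [F HF].
destruct Hsc as (_ & HO & _); destruct HC as (HP & HQ & _).
exists (fun x y => 2 * (F x y - F x0 y0) + c); intros x y g1 g2 _ Hg.
rewrite (line_int_potential Om Psi F g1 g2 x0 y0 x y HO HP HQ HF Hg); reflexivity.
Qed.

(** [is_Abar] says nothing at a point that no C^1 curve reaches. Since [reach_exists] supplies a
    curve to every point, [U] equals twice the potential up to a constant on all of [Om], and
    openness transfers the derivatives. *)
Lemma is_Abar_grad (Om : R -> R -> Prop) (Psi : R -> R -> C) (x0 y0 c : R) (U : R -> R -> R) :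
  simply_connected_domain Om -> closed_form Om (ReF Psi) (ImF Psi) -> Om x0 y0 ->
  is_Abar Om Psi x0 y0 c U ->
  grad_on Om U (fun x y => 2 * ReF Psi x y) (fun x y => 2 * ImF Psi x y).
Proof.
intros Hsc HC H0 HU.
destruct (potential_exists Om _ _ Hsc HC) as [F HF].
destruct Hsc as (_ & HO & Hpc & _).
assert (HUF : forall x y, Om x y -> 2 * (F x y - F x0 y0) + c = U x y).
{ intros x y Hxy.
  destruct (reach_exists Om _ _ x0 y0 x y HO Hpc HC H0 Hxy) as [v Hv].
  destruct (reach_C1_curve _ _ _ _ _ _ _ _ Hv) as (g1 & g2 & Hg).
  destruct HC as (HP & HQ & _).
  rewrite (HU x y g1 g2 Hxy Hg).
  rewrite (line_int_potential Om Psi F g1 g2 x0 y0 x y HO HP HQ HF Hg); reflexivity. }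
intros x y Hxy; destruct (HF x y Hxy) as [Hx Hy]; split.
- apply (is_derive_ext_loc (fun t => 2 * (F t y - F x0 y0) + c)).
  + generalize (open2_locally_x Om x y HO Hxy); apply filter_imp.
    intros t Ht; apply HUF, Ht.
  + apply (is_derive_2_minus (fun t => F t y)), Hx.
- apply (is_derive_ext_loc (fun t => 2 * (F x t - F x0 y0) + c)).
  + generalize (open2_locally_y Om x y HO Hxy); apply filter_imp.
    intros t Ht; apply HUF, Ht.
  + apply (is_derive_2_minus (fun t => F x t)), Hy.
Qed.

(** * Calculus of C^1 and C^2 functions on an open set *)

Lemma grad_on_dx (Om : R -> R -> Prop) (u a b : R -> R -> R) (x y : R) :
  grad_on Om u a b -> Om x y -> dx u x y = a x y.
Proof. intros H Hxy; apply is_derive_unique, H, Hxy. Qed.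

Lemma grad_on_dy (Om : R -> R -> Prop) (u a b : R -> R -> R) (x y : R) :
  grad_on Om u a b -> Om x y -> dy u x y = b x y.
Proof. intros H Hxy; apply is_derive_unique, H, Hxy. Qed.

Lemma grad_on_ext (Om : R -> R -> Prop) (u v a b a' b' : R -> R -> R) :
  open2 Om -> (forall x y, Om x y -> u x y = v x y) ->
  (forall x y, Om x y -> a x y = a' x y) -> (forall x y, Om x y -> b x y = b' x y) ->
  grad_on Om u a b -> grad_on Om v a' b'.
Proof.
intros HO Hu Ha Hb HG x y Hxy; destruct (HG x y Hxy) as [Hx Hy]; split.
- rewrite <- Ha by exact Hxy.
  apply (is_derive_ext_loc (fun t => u t y)); [|exact Hx].
  generalize (open2_locally_x Om x y HO Hxy); apply filter_imp; intros t Ht; apply Hu, Ht.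
- rewrite <- Hb by exact Hxy.
  apply (is_derive_ext_loc (fun t => u x t)); [|exact Hy].
  generalize (open2_locally_y Om x y HO Hxy); apply filter_imp; intros t Ht; apply Hu, Ht.
Qed.

(** Explicit gradient components [a] and [b] turn a Laplacian into algebra that [field] can finish.
    They agree with [dx u] and [dy u] on [Om] only, and openness allows this equality to be
    differentiated. *)
Lemma lap_of_grad (Om : R -> R -> Prop) (u a b a1 a2 b1 b2 : R -> R -> R) (x y : R) :
  open2 Om -> grad_on Om u a b -> grad_on Om a a1 a2 -> grad_on Om b b1 b2 -> Om x y ->
  lap u x y = a1 x y + b2 x y.
Proof.
intros HO Hu Ha Hb Hxy; unfold lap; f_equal.
- apply (grad_on_dx Om _ a1 a2); [|exact Hxy].
  apply (grad_on_ext Om a (dx u) a1 a2); auto.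
  intros u' v' H; symmetry; apply (grad_on_dx Om u a b); assumption.
- apply (grad_on_dy Om _ b1 b2); [|exact Hxy].
  apply (grad_on_ext Om b (dy u) b1 b2); auto.
  intros u' v' H; symmetry; apply (grad_on_dy Om u a b); assumption.
Qed.

Lemma grad_on_const (Om : R -> R -> Prop) (c : R) :
  grad_on Om (fun _ _ => c) (fun _ _ => 0) (fun _ _ => 0).
Proof.
intros x y _; split; apply (is_derive_const (K := R_AbsRing) (V := R_NormedModule)).
Qed.

Lemma grad_on_plus (Om : R -> R -> Prop) (u v a b a' b' : R -> R -> R) :
  grad_on Om u a b -> grad_on Om v a' b' ->
  grad_on Om (fun x y => u x y + v x y)
    (fun x y => a x y + a' x y) (fun x y => b x y + b' x y).
Proof.
intros Hu Hv x y Hxy; destruct (Hu x y Hxy) as [Hx Hy], (Hv x y Hxy) as [Hx' Hy'].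
split.
- exact (is_derive_plus (K := R_AbsRing) (V := R_NormedModule) _ _ _ _ _ Hx Hx').
- exact (is_derive_plus (K := R_AbsRing) (V := R_NormedModule) _ _ _ _ _ Hy Hy').
Qed.

Lemma grad_on_opp (Om : R -> R -> Prop) (u a b : R -> R -> R) :
  grad_on Om u a b -> grad_on Om (fun x y => - u x y) (fun x y => - a x y) (fun x y => - b x y).
Proof.
intros Hu x y Hxy; destruct (Hu x y Hxy) as [Hx Hy]; split.
- exact (is_derive_opp (K := R_AbsRing) (V := R_NormedModule) _ _ _ Hx).
- exact (is_derive_opp (K := R_AbsRing) (V := R_NormedModule) _ _ _ Hy).
Qed.

Lemma grad_on_mult (Om : R -> R -> Prop) (u v a b a' b' : R -> R -> R) :
  grad_on Om u a b -> grad_on Om v a' b' ->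
  grad_on Om (fun x y => u x y * v x y)
    (fun x y => a x y * v x y + u x y * a' x y) (fun x y => b x y * v x y + u x y * b' x y).
Proof.
intros Hu Hv x y Hxy; destruct (Hu x y Hxy) as [Hx Hy], (Hv x y Hxy) as [Hx' Hy'].
split.
- exact (Derive.is_derive_mult _ _ _ _ _ Hx Hx').
- exact (Derive.is_derive_mult _ _ _ _ _ Hy Hy').
Qed.

(** The components are products with [/ u x y] and contain no square, so that this rule and the
    product rule apply to them again for second derivatives. *)
Lemma grad_on_inv (Om : R -> R -> Prop) (u a b : R -> R -> R) :
  (forall x y, Om x y -> u x y <> 0) -> grad_on Om u a b ->
  grad_on Om (fun x y => / u x y)
    (fun x y => - a x y * / u x y * / u x y) (fun x y => - b x y * / u x y * / u x y).
Proof.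
intros H0 Hu x y Hxy; destruct (Hu x y Hxy) as [Hx Hy]; assert (H := H0 x y Hxy).
split.
- replace (- a x y * / u x y * / u x y) with (- a x y / u x y ^ 2) by (field; exact H).
  exact (is_derive_inv _ _ _ Hx H).
- replace (- b x y * / u x y * / u x y) with (- b x y / u x y ^ 2) by (field; exact H).
  exact (is_derive_inv _ _ _ Hy H).
Qed.

Lemma cont2_ext (Om : R -> R -> Prop) (u v : R -> R -> R) (x y : R) :
  open2 Om -> (forall x y, Om x y -> u x y = v x y) -> Om x y -> cont2 u x y -> cont2 v x y.
Proof.
intros HO H Hxy Hu.
apply (continuous_ext_loc _ (fun p : R * R => u (fst p) (snd p))); [|exact Hu].
generalize (open2_locally Om x y HO Hxy); apply filter_imp; intros p Hp; apply H, Hp.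
Qed.

Lemma cont2_plus (u v : R -> R -> R) (x y : R) :
  cont2 u x y -> cont2 v x y -> cont2 (fun x y => u x y + v x y) x y.
Proof. exact (continuous_plus (V := R_NormedModule) _ _ (x, y)). Qed.

Lemma cont2_mult (u v : R -> R -> R) (x y : R) :
  cont2 u x y -> cont2 v x y -> cont2 (fun x y => u x y * v x y) x y.
Proof. exact (continuous_mult (K := R_AbsRing) _ _ (x, y)). Qed.

Lemma cont2_inv (u : R -> R -> R) (x y : R) :
  cont2 u x y -> u x y <> 0 -> cont2 (fun x y => / u x y) x y.
Proof.
intros Hu H0; apply (continuous_comp (fun p : R * R => u (fst p) (snd p)) Rinv);
  [exact Hu|apply continuous_Rinv, H0].
Qed.

Lemma C1_on_of_grad (Om : R -> R -> Prop) (u a b : R -> R -> R) :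
  open2 Om -> grad_on Om u a b ->
  (forall x y, Om x y -> cont2 a x y) -> (forall x y, Om x y -> cont2 b x y) -> C1_on Om u.
Proof.
intros HO HG Ha Hb x y Hxy.
destruct (HG x y Hxy) as [Hx Hy].
split; [exists (a x y); exact Hx|split; [exists (b x y); exact Hy|split; [|split]]].
- apply (grad_on_cont2 Om u a b); auto.
- apply (cont2_ext Om a); auto.
  intros x' y' H; symmetry; apply (grad_on_dx Om u a b); assumption.
- apply (cont2_ext Om b); auto.
  intros x' y' H; symmetry; apply (grad_on_dy Om u a b); assumption.
Qed.

Lemma C1_on_ext (Om : R -> R -> Prop) (u v : R -> R -> R) :
  open2 Om -> (forall x y, Om x y -> u x y = v x y) -> C1_on Om u -> C1_on Om v.
Proof.
intros HO H Hu; apply (C1_on_of_grad Om v (dx u) (dy u) HO).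
- apply (grad_on_ext Om u v (dx u) (dy u)); auto; apply C1_on_grad, Hu.
- intros x y; apply C1_on_cont_dx, Hu.
- intros x y; apply C1_on_cont_dy, Hu.
Qed.

Lemma C1_on_const (Om : R -> R -> Prop) (c : R) : open2 Om -> C1_on Om (fun _ _ => c).
Proof.
intros HO; apply (C1_on_of_grad Om _ _ _ HO (grad_on_const Om c)); intros x y _;
  apply continuous_const.
Qed.

Lemma C1_on_plus (Om : R -> R -> Prop) (u v : R -> R -> R) :
  open2 Om -> C1_on Om u -> C1_on Om v -> C1_on Om (fun x y => u x y + v x y).
Proof.
intros HO Hu Hv.
apply (C1_on_of_grad Om _ _ _ HO
  (grad_on_plus Om u v _ _ _ _ (C1_on_grad _ _ Hu) (C1_on_grad _ _ Hv))); intros x y Hxy.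
- exact (cont2_plus _ _ x y (C1_on_cont_dx _ _ x y Hu Hxy) (C1_on_cont_dx _ _ x y Hv Hxy)).
- exact (cont2_plus _ _ x y (C1_on_cont_dy _ _ x y Hu Hxy) (C1_on_cont_dy _ _ x y Hv Hxy)).
Qed.

Lemma C1_on_mult (Om : R -> R -> Prop) (u v : R -> R -> R) :
  open2 Om -> C1_on Om u -> C1_on Om v -> C1_on Om (fun x y => u x y * v x y).
Proof.
intros HO Hu Hv.
apply (C1_on_of_grad Om _ _ _ HO
  (grad_on_mult Om u v _ _ _ _ (C1_on_grad _ _ Hu) (C1_on_grad _ _ Hv))); intros x y Hxy;
  assert (Cu := C1_on_cont _ _ x y Hu Hxy); assert (Cv := C1_on_cont _ _ x y Hv Hxy).
- exact (cont2_plus _ _ x y (cont2_mult _ _ x y (C1_on_cont_dx _ _ x y Hu Hxy) Cv)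
    (cont2_mult _ _ x y Cu (C1_on_cont_dx _ _ x y Hv Hxy))).
- exact (cont2_plus _ _ x y (cont2_mult _ _ x y (C1_on_cont_dy _ _ x y Hu Hxy) Cv)
    (cont2_mult _ _ x y Cu (C1_on_cont_dy _ _ x y Hv Hxy))).
Qed.

Lemma C1_on_opp (Om : R -> R -> Prop) (u : R -> R -> R) :
  open2 Om -> C1_on Om u -> C1_on Om (fun x y => - u x y).
Proof.
intros HO Hu; apply (C1_on_ext Om (fun x y => -1 * u x y) _ HO); [intros; ring|].
apply C1_on_mult; [exact HO|apply C1_on_const, HO|exact Hu].
Qed.

Lemma C1_on_inv (Om : R -> R -> Prop) (u : R -> R -> R) :
  open2 Om -> (forall x y, Om x y -> u x y <> 0) -> C1_on Om u ->
  C1_on Om (fun x y => / u x y).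
Proof.
intros HO H0 Hu.
assert (Hi : forall x y, Om x y -> cont2 (fun x y => / u x y) x y)
  by (intros x y Hxy; apply cont2_inv; [apply (C1_on_cont Om); assumption|auto]).
assert (Ho : forall v x y, Om x y -> cont2 v x y ->
  cont2 (fun x y => - v x y * / u x y * / u x y) x y).
{ intros v x y Hxy Hv.
  assert (Hv' : cont2 (fun x y => - v x y) x y)
    by exact (continuous_opp (V := R_NormedModule) _ (x, y) Hv).
  exact (cont2_mult _ _ x y (cont2_mult _ _ x y Hv' (Hi x y Hxy)) (Hi x y Hxy)). }
apply (C1_on_of_grad Om _ _ _ HO (grad_on_inv Om u _ _ H0 (C1_on_grad _ _ Hu)));
  intros x y Hxy.
- exact (Ho _ x y Hxy (C1_on_cont_dx _ _ x y Hu Hxy)).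
- exact (Ho _ x y Hxy (C1_on_cont_dy _ _ x y Hu Hxy)).
Qed.

Lemma C2_on_of_grad (Om : R -> R -> Prop) (u a b : R -> R -> R) :
  open2 Om -> grad_on Om u a b -> C1_on Om a -> C1_on Om b -> C2_on Om u.
Proof.
intros HO HG Ha Hb; split; [|split].
- apply (C1_on_of_grad Om u a b HO HG); intros x y; apply C1_on_cont; assumption.
- apply (C1_on_ext Om a); auto.
  intros x' y' H; symmetry; apply (grad_on_dx Om u a b); assumption.
- apply (C1_on_ext Om b); auto.
  intros x' y' H; symmetry; apply (grad_on_dy Om u a b); assumption.
Qed.

Lemma C2_on_inv (Om : R -> R -> Prop) (u : R -> R -> R) :
  open2 Om -> (forall x y, Om x y -> u x y <> 0) -> C2_on Om u ->
  C2_on Om (fun x y => / u x y).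
Proof.
intros HO H0 (Hu & Hux & Huy).
assert (Hi := C1_on_inv Om u HO H0 Hu).
exact (C2_on_of_grad Om _ _ _ HO (grad_on_inv Om u _ _ H0 (C1_on_grad _ _ Hu))
  (C1_on_mult Om _ _ HO (C1_on_mult Om _ _ HO (C1_on_opp Om _ HO Hux) Hi) Hi)
  (C1_on_mult Om _ _ HO (C1_on_mult Om _ _ HO (C1_on_opp Om _ HO Huy) Hi) Hi)).
Qed.

Lemma dx_dy_comm (Om : R -> R -> Prop) (u : R -> R -> R) (x y : R) :
  open2 Om -> C2_on Om u -> Om x y -> dx (dy u) x y = dy (dx u) x y.
Proof.
intros HO (Hu & Hux & Huy) Hxy.
apply (Schwarz u x y).
- apply locally_2d_locally.
  generalize (open2_locally Om x y HO Hxy); apply filter_imp; intros [a b] Hab.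
  destruct (Hu a b Hab) as (H1 & H2 & _), (Hux a b Hab) as (_ & H3 & _), (Huy a b Hab) as (H4 & _).
  exact (conj H1 (conj H2 (conj H4 H3))).
- apply continuity_2d_pt_filterlim, (C1_on_cont_dx Om _ x y Huy Hxy).
- apply continuity_2d_pt_filterlim, (C1_on_cont_dy Om _ x y Hux Hxy).
Qed.

(** * Wronskian fields and conjugate functions *)

Lemma grad_on_wronskian (Om : R -> R -> Prop) (u v p q p1 p2 q1 q2 : R -> R -> R) :
  C1_on Om u -> C1_on Om v -> grad_on Om p p1 p2 -> grad_on Om q q1 q2 ->
  grad_on Om (fun x y => u x y * q x y + -1 * (v x y * p x y))
    (fun x y => dx u x y * q x y + u x y * q1 x y - (dx v x y * p x y + v x y * p1 x y))
    (fun x y => dy u x y * q x y + u x y * q2 x y - (dy v x y * p x y + v x y * p2 x y)).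
Proof.
intros Hu Hv Hp Hq x y Hxy.
destruct (grad_on_plus Om _ _ _ _ _ _ 
  (grad_on_mult Om _ _ _ _ _ _ (C1_on_grad _ _ Hu) Hq)
  (grad_on_mult Om _ _ _ _ _ _ (grad_on_const Om (-1))
    (grad_on_mult Om _ _ _ _ _ _ (C1_on_grad _ _ Hv) Hp)) x y Hxy) as [H1 H2].
split.
- match type of H1 with is_derive _ _ ?l =>
    match goal with |- is_derive _ _ ?r => replace r with l by ring end end; exact H1.
- match type of H2 with is_derive _ _ ?l =>
    match goal with |- is_derive _ _ ?r => replace r with l by ring end end; exact H2.
Qed.

Lemma C1_on_wronskian (Om : R -> R -> Prop) (k : R) (u v p q : R -> R -> R) :
  open2 Om -> C1_on Om u -> C1_on Om v -> C1_on Om p -> C1_on Om q ->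
  C1_on Om (fun x y => k * (u x y * q x y + -1 * (v x y * p x y))).
Proof.
intros HO Hu Hv Hp Hq.
exact (C1_on_mult Om _ _ HO (C1_on_const Om k HO) (C1_on_plus Om _ _ HO
  (C1_on_mult Om _ _ HO Hu Hq)
  (C1_on_mult Om _ _ HO (C1_on_const Om (-1) HO) (C1_on_mult Om _ _ HO Hv Hp)))).
Qed.

(* With [u = w / h], this says [Psi = i h^2 d_zbar u]: the brackets are [h^2 u_y] and
   [h^2 u_x]. *)
Definition wronskian_field (Om : R -> R -> Prop) (h w : R -> R -> R) (Psi : R -> R -> C) : Prop :=
  forall x y, Om x y ->
    ReF Psi x y = - / 2 * (h x y * dy w x y + -1 * (w x y * dy h x y)) /\
    ImF Psi x y = / 2 * (h x y * dx w x y + -1 * (w x y * dx h x y)).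

(** Green's identity: in [P_y - Q_x] the products [h_x w_x] and [h_y w_y] cancel, leaving
    [- (h lap w - w lap h) / 2], which vanishes by assumption. *)
Lemma wronskian_field_closed (Om : R -> R -> Prop) (h w : R -> R -> R) (Psi : R -> R -> C) :
  open2 Om -> C2_on Om h -> C2_on Om w ->
  (forall x y, Om x y -> h x y * lap w x y = w x y * lap h x y) ->
  wronskian_field Om h w Psi -> closed_form Om (ReF Psi) (ImF Psi).
Proof.
intros HO (Hh & Hhx & Hhy) (Hw & Hwx & Hwy) Hlap HPsi.
split; [|split].
- apply (C1_on_ext Om (fun x y => - / 2 * (h x y * dy w x y + -1 * (w x y * dy h x y))) _ HO);
    [intros x y Hxy; symmetry; apply HPsi, Hxy|].
  apply C1_on_wronskian; assumption.
- apply (C1_on_ext Om (fun x y => / 2 * (h x y * dx w x y + -1 * (w x y * dx h x y))) _ HO);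
    [intros x y Hxy; symmetry; apply HPsi, Hxy|].
  apply C1_on_wronskian; assumption.
- intros x y Hxy.
  assert (GR := grad_on_mult Om _ _ _ _ _ _ (grad_on_const Om (- / 2))
    (grad_on_wronskian Om h w _ _ _ _ _ _ Hh Hw (C1_on_grad _ _ Hhy) (C1_on_grad _ _ Hwy))).
  assert (GI := grad_on_mult Om _ _ _ _ _ _ (grad_on_const Om (/ 2))
    (grad_on_wronskian Om h w _ _ _ _ _ _ Hh Hw (C1_on_grad _ _ Hhx) (C1_on_grad _ _ Hwx))).
  assert (HR : forall x y, Om x y -> - / 2 * (h x y * dy w x y + -1 * (w x y * dy h x y)) = ReF Psi x y)
    by (intros; symmetry; apply HPsi; assumption).
  assert (HI : forall x y, Om x y -> / 2 * (h x y * dx w x y + -1 * (w x y * dx h x y)) = ImF Psi x y)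
    by (intros; symmetry; apply HPsi; assumption).
  assert (Erefl : forall u x y, Om x y -> u x y = u x y :> R) by reflexivity.
  rewrite (grad_on_dy Om _ _ _ x y (grad_on_ext Om _ _ _ _ _ _ HO HR (Erefl _) (Erefl _) GR) Hxy).
  rewrite (grad_on_dx Om _ _ _ x y (grad_on_ext Om _ _ _ _ _ _ HO HI (Erefl _) (Erefl _) GI) Hxy).
  assert (HL := Hlap x y Hxy); unfold lap in HL; nra.
Qed.

(** Differentiating [h V = k U] gives both first-order formulas, as [U] has gradient [2 Psi]. In the
    Laplacian the brackets contribute [2 k (w_x h_y - w_y h_x) / h], once the mixed second
    derivatives have cancelled by symmetry; the same quantity comes with opposite sign from
    [- 2 (grad V . grad h) / h], and only multiples of [V] are left. *)
Lemma wronskian_conjugate (Om : R -> R -> Prop) (h w : R -> R -> R) (Psi : R -> R -> C)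
  (x0 y0 c k : R) (U V : R -> R -> R) :
  simply_connected_domain Om -> C2_on Om h -> C2_on Om w ->
  (forall x y, Om x y -> h x y <> 0) ->
  (forall x y, Om x y -> h x y * lap w x y = w x y * lap h x y) ->
  wronskian_field Om h w Psi -> Om x0 y0 -> is_Abar Om Psi x0 y0 c U ->
  (forall x y, Om x y -> V x y = k * U x y / h x y) ->
  C2_on Om V /\
  (forall x y, Om x y ->
     dx V x y = (- k * (h x y * dy w x y - w x y * dy h x y) - V x y * dx h x y) / h x y /\
     dy V x y = (k * (h x y * dx w x y - w x y * dx h x y) - V x y * dy h x y) / h x y /\
     lap V x y = (2 * grad2 h x y / h x y ^ 2 - lap h x y / h x y) * V x y).
Proof.
intros Hsc Hh2 Hw2 Hn Hlap HPsi H0 HU HV.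
assert (HO : open2 Om) by apply Hsc.
assert (HGU := is_Abar_grad Om Psi x0 y0 c U Hsc
  (wronskian_field_closed Om h w Psi HO Hh2 Hw2 Hlap HPsi) H0 HU).
destruct Hh2 as (Hh & Hhx & Hhy); destruct Hw2 as (Hw & Hwx & Hwy).
assert (Gh := C1_on_grad _ _ Hh).
assert (Gi := grad_on_inv Om h _ _ Hn Gh).
assert (Hi := C1_on_inv Om h HO Hn Hh).
set (A := fun x y => - k * (h x y * dy w x y + -1 * (w x y * dy h x y))).
set (B := fun x y => k * (h x y * dx w x y + -1 * (w x y * dx h x y))).
assert (HA : C1_on Om A)
  by (apply C1_on_wronskian; assumption).
assert (HB : C1_on Om B)
  by (apply C1_on_wronskian; assumption).
assert (GA := grad_on_mult Om _ _ _ _ _ _ (grad_on_const Om (- k))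
  (grad_on_wronskian Om h w _ _ _ _ _ _ Hh Hw (C1_on_grad _ _ Hhy) (C1_on_grad _ _ Hwy))).
assert (GB := grad_on_mult Om _ _ _ _ _ _ (grad_on_const Om k)
  (grad_on_wronskian Om h w _ _ _ _ _ _ Hh Hw (C1_on_grad _ _ Hhx) (C1_on_grad _ _ Hwx))).
fold A in GA; fold B in GB.
(* [a] and [b] contain [V] itself, so [GV] can be fed back to obtain their derivatives in [Ga] and
   [Gb]. The factor [-1] mirrors the shape that the gradient rules produce. *)
set (a := fun x y => (A x y + -1 * (V x y * dx h x y)) * / h x y).
set (b := fun x y => (B x y + -1 * (V x y * dy h x y)) * / h x y).
assert (GV : grad_on Om V a b).
{ eapply (grad_on_ext Om (fun x y => k * U x y * / h x y) V); [exact HO| | | |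
    exact (grad_on_mult Om _ _ _ _ _ _ (grad_on_mult Om _ _ _ _ _ _ (grad_on_const Om k) HGU) Gi)].
  - intros x y Hxy; rewrite HV by exact Hxy; reflexivity.
  - intros x y Hxy; unfold a, A; rewrite HV by exact Hxy.
    destruct (HPsi x y Hxy) as [-> _]; field; apply Hn, Hxy.
  - intros x y Hxy; unfold b, B; rewrite HV by exact Hxy.
    destruct (HPsi x y Hxy) as [_ ->]; field; apply Hn, Hxy. }
assert (HV1 : C1_on Om V).
{ apply (C1_on_ext Om (fun x y => k * U x y * / h x y) V HO).
  - intros x y Hxy; rewrite HV by exact Hxy; reflexivity.
  - refine (C1_on_mult Om _ _ HO (C1_on_mult Om _ _ HO (C1_on_const Om k HO) _) Hi).
    destruct (wronskian_field_closed Om h w Psi HO (conj Hh (conj Hhx Hhy))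
      (conj Hw (conj Hwx Hwy)) Hlap HPsi) as (HP & HQ & _).
    apply (C1_on_of_grad Om U _ _ HO HGU); intros x y Hxy;
      (apply (cont2_mult (fun _ _ => 2)); [apply continuous_const|]).
    + apply (C1_on_cont Om _ _ _ HP Hxy).
    + apply (C1_on_cont Om _ _ _ HQ Hxy). }
assert (Ga := grad_on_mult Om _ _ _ _ _ _ (grad_on_plus Om _ _ _ _ _ _ GA
  (grad_on_mult Om _ _ _ _ _ _ (grad_on_const Om (-1))
    (grad_on_mult Om _ _ _ _ _ _ GV (C1_on_grad _ _ Hhx)))) Gi).
assert (Gb := grad_on_mult Om _ _ _ _ _ _ (grad_on_plus Om _ _ _ _ _ _ GB
  (grad_on_mult Om _ _ _ _ _ _ (grad_on_const Om (-1))
    (grad_on_mult Om _ _ _ _ _ _ GV (C1_on_grad _ _ Hhy)))) Gi).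
fold a in Ga; fold b in Gb.
split.
- assert (Hab : forall A d, C1_on Om A -> C1_on Om d ->
    C1_on Om (fun x y => (A x y + -1 * (V x y * d x y)) * / h x y)).
  { intros A' d HA' Hd.
    exact (C1_on_mult Om _ _ HO (C1_on_plus Om _ _ HO HA' (C1_on_mult Om _ _ HO
      (C1_on_const Om (-1) HO) (C1_on_mult Om _ _ HO HV1 Hd))) Hi). }
  exact (C2_on_of_grad Om V a b HO GV (Hab A _ HA Hhx) (Hab B _ HB Hhy)).
- intros x y Hxy; split; [|split].
  + rewrite (grad_on_dx Om V a b x y GV Hxy); unfold a, A; field; apply Hn, Hxy.
  + rewrite (grad_on_dy Om V a b x y GV Hxy); unfold b, B; field; apply Hn, Hxy.
  + rewrite (lap_of_grad Om V a b _ _ _ _ x y HO GV Ga Gb Hxy); cbv beta; unfold a, b, A, B, lap, grad2.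
    rewrite (dx_dy_comm Om h x y HO (conj Hh (conj Hhx Hhy)) Hxy).
    rewrite (dx_dy_comm Om w x y HO (conj Hw (conj Hwx Hwy)) Hxy).
    field; apply Hn, Hxy.
Qed.

(** The right side is [r2 / f] for the [r2] of the theorem, so the equation of part (ii) becomes
    [h lap W2 = W2 lap h] with [h = 1 / f]. *)
Lemma lap_inv (Om : R -> R -> Prop) (f : R -> R -> R) (x y : R) :
  open2 Om -> C2_on Om f -> (forall x y, Om x y -> f x y <> 0) -> Om x y ->
  lap (fun x y => / f x y) x y = (2 * grad2 f x y / f x y ^ 2 - lap f x y / f x y) / f x y.
Proof.
intros HO (Hf & Hfx & Hfy) H0 Hxy.
assert (Gi := grad_on_inv Om f _ _ H0 (C1_on_grad _ _ Hf)).
rewrite (lap_of_grad Om _ _ _ _ _ _ _ x y HO Gi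
  (grad_on_mult Om _ _ _ _ _ _ (grad_on_mult Om _ _ _ _ _ _ (grad_on_opp Om _ _ _ (C1_on_grad _ _ Hfx)) Gi) Gi)
  (grad_on_mult Om _ _ _ _ _ _ (grad_on_mult Om _ _ _ _ _ _ (grad_on_opp Om _ _ _ (C1_on_grad _ _ Hfy)) Gi) Gi) Hxy).
unfold lap, grad2; field; apply H0, Hxy.
Qed.

(** * The operator [dzbar] in real components, and the theorem *)

Lemma dzbar_toC (u : R -> R -> R) (x y : R) :
  dzbar (toC u) x y = (/ 2 * dx u x y, / 2 * dy u x y).
Proof.
assert (HR : ReF (toC u) = u) by reflexivity.
assert (Hx : dx (ImF (toC u)) x y = 0) by exact (Derive_const 0 _).
assert (Hy : dy (ImF (toC u)) x y = 0) by exact (Derive_const 0 _).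
unfold dzbar; rewrite HR, Hx, Hy.
apply injective_projections; simpl; ring.
Qed.

Lemma dzbar_pair (u v : R -> R -> R) (x y : R) :
  dzbar (fun x y => (u x y, v x y)) x y =
  (/ 2 * (dx u x y - dy v x y), / 2 * (dy u x y + dx v x y)).
Proof.
unfold dzbar.
change (ReF (fun x y => (u x y, v x y))) with u.
change (ImF (fun x y => (u x y, v x y))) with v.
apply injective_projections; simpl; ring.
Qed.

Lemma Cmult_Cdiv_Cconj (a b f p q : R) : f <> 0 ->
  Cmult (Cdiv (a, b) (RtoC f)) (Cconj (p, q)) = ((a * p + b * q) / f, (b * p - a * q) / f).
Proof.
intros Hf; apply injective_projections; simpl; field; exact Hf.
Qed.

Theorem mainTheorem8 :
  forall (Om : R -> R -> Prop) (f : R -> R -> R),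
  simply_connected_domain Om ->
  C2_on Om f ->
  (forall x y, Om x y -> 0 < f x y) ->
  let r1 := fun x y => lap f x y / f x y in
  let r2 := fun x y => 2 * grad2 f x y / (f x y) ^ 2 - r1 x y in
  (* (i) *)
  (forall W1 : R -> R -> R,
     C2_on Om W1 ->
     (forall x y, Om x y -> - lap W1 x y + r1 x y * W1 x y = 0) ->
     let Psi := fun x y =>
       Cmult Ci (Cmult (RtoC ((f x y) ^ 2))
                       (dzbar (toC (fun a b => W1 a b / f a b)) x y)) in
     Abar_compatible Om Psi /\
     forall x0 y0 c, Om x0 y0 ->
       (exists U, is_Abar Om Psi x0 y0 c U) /\
       forall U, is_Abar Om Psi x0 y0 c U ->
         let W2 := fun x y => U x y / f x y in
         let W := fun x y => ((W1 x y, W2 x y) : C) in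
         C2_on Om W2 /\
         (forall x y, Om x y -> - lap W2 x y + r2 x y * W2 x y = 0) /\
         (forall x y, Om x y ->
            dzbar W x y = Cmult (Cdiv (dzbar (toC f) x y) (RtoC (f x y)))
                                (Cconj (W x y)))) /\
  (* (ii) *)
  (forall W2 : R -> R -> R,
     C2_on Om W2 ->
     (forall x y, Om x y -> - lap W2 x y + r2 x y * W2 x y = 0) ->
     let Psi := fun x y =>
       Cmult Ci (Cmult (RtoC (/ (f x y) ^ 2))
                       (dzbar (toC (fun a b => f a b * W2 a b)) x y)) in
     forall x0 y0 c, Om x0 y0 ->
       (exists U, is_Abar Om Psi x0 y0 c U) /\
       forall U, is_Abar Om Psi x0 y0 c U ->
         let W1 := fun x y => - f x y * U x y in
         let W := fun x y => ((W1 x y, W2 x y) : C) in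
         C2_on Om W1 /\
         (forall x y, Om x y -> - lap W1 x y + r1 x y * W1 x y = 0) /\
         (forall x y, Om x y ->
            dzbar W x y = Cmult (Cdiv (dzbar (toC f) x y) (RtoC (f x y)))
                                (Cconj (W x y)))).
Proof.
intros Om f Hsc Hf Hpos r1 r2.
assert (HO : open2 Om) by apply Hsc.
assert (Hn : forall x y, Om x y -> f x y <> 0)
  by (intros x y Hxy; apply Rgt_not_eq, Hpos, Hxy).
assert (Gf := C1_on_grad _ _ (proj1 Hf)).
split.
- intros W1 HW1 Heq Psi.
  assert (Hlap : forall x y, Om x y -> f x y * lap W1 x y = W1 x y * lap f x y).
  { intros x y Hxy; assert (H := Heq x y Hxy); unfold r1 in H.
    replace (lap W1 x y) with (lap f x y / f x y * W1 x y) by lra.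
    field; apply Hn, Hxy. }
  assert (HPsi : wronskian_field Om f W1 Psi).
  { intros x y Hxy.
    assert (Gq := grad_on_mult Om _ _ _ _ _ _ (C1_on_grad _ _ (proj1 HW1)) (grad_on_inv Om f _ _ Hn Gf)).
    assert (Ex := grad_on_dx Om _ _ _ x y Gq Hxy).
    assert (Ey := grad_on_dy Om _ _ _ x y Gq Hxy).
    unfold ReF, ImF, Psi; rewrite dzbar_toC; unfold Rdiv; rewrite Ex, Ey; simpl.
    split; field; apply Hn, Hxy. }
  assert (HC := wronskian_field_closed Om f W1 Psi HO Hf HW1 Hlap HPsi).
  split; [intros x y Hxy; apply Rminus_diag_eq, HC, Hxy|].
  intros x0 y0 c H0; split; [apply is_Abar_exists; assumption|].
  intros U HU W2 W.
  destruct (wronskian_conjugate Om f W1 Psi x0 y0 c 1 U W2 Hsc Hf HW1 Hn Hlap HPsi H0 HU)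
    as [HW2 HD].
  { intros x y Hxy; unfold W2; rewrite Rmult_1_l; reflexivity. }
  split; [exact HW2|split]; intros x y Hxy; destruct (HD x y Hxy) as (Ex & Ey & EL).
  + rewrite EL; unfold r2, r1; ring.
  (* In real components the equation says [W1_x - W2_y = (f_x W1 + f_y W2) / f] and
     [W1_y + W2_x = (f_y W1 - f_x W2) / f]; these are [Ey] and [Ex] rearranged. *)
  + unfold W; rewrite dzbar_pair, dzbar_toC, Cmult_Cdiv_Cconj, Ex, Ey by (apply Hn, Hxy).
    apply injective_projections; simpl; field; apply Hn, Hxy.
- intros W2 HW2 Heq Psi x0 y0 c H0.
  set (h := fun x y => / f x y).
  assert (Hh : C2_on Om h) by (apply C2_on_inv; assumption).
  assert (Hhn : forall x y, Om x y -> h x y <> 0)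
    by (intros x y Hxy; apply Rinv_neq_0_compat, Hn, Hxy).
  assert (Gh := grad_on_inv Om f _ _ Hn Gf); fold h in Gh.
  assert (Hlap : forall x y, Om x y -> h x y * lap W2 x y = W2 x y * lap h x y).
  { intros x y Hxy; assert (H := Heq x y Hxy).
    unfold h at 2; rewrite (lap_inv Om f x y HO Hf Hn Hxy).
    unfold r2, r1 in H; unfold h, Rdiv; rewrite <- (Rmult_assoc (W2 x y)).
    rewrite (Rmult_comm (/ f x y)); f_equal; unfold Rdiv in H; lra. }
  assert (HPsi : wronskian_field Om h W2 Psi).
  { intros x y Hxy.
    assert (Gq := grad_on_mult Om _ _ _ _ _ _ Gf (C1_on_grad _ _ (proj1 HW2))).
    assert (Ex := grad_on_dx Om _ _ _ x y Gq Hxy).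
    assert (Ey := grad_on_dy Om _ _ _ x y Gq Hxy).
    unfold ReF, ImF, Psi; rewrite dzbar_toC, Ex, Ey; simpl.
    rewrite (grad_on_dx Om h _ _ x y Gh Hxy), (grad_on_dy Om h _ _ x y Gh Hxy); unfold h.
    split; field; apply Hn, Hxy. }
  split; [apply is_Abar_exists; [exact Hsc|]; apply (wronskian_field_closed Om h W2); assumption|].
  intros U HU W1 W.
  destruct (wronskian_conjugate Om h W2 Psi x0 y0 c (-1) U W1 Hsc Hh HW2 Hhn Hlap HPsi H0 HU)
    as [HW1 HD].
  { intros x y Hxy; unfold W1, h; field; apply Hn, Hxy. }
  split; [exact HW1|split]; intros x y Hxy; destruct (HD x y Hxy) as (Ex & Ey & EL).
  (* With [h = 1 / f] the term [2 grad2 h / h^2] equals [2 grad2 f / f^2] and cancels the same term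
     of [lap h / h]; what is left is [lap f / f], that is [r1]. *)
  + rewrite EL; unfold h at 3; rewrite (lap_inv Om f x y HO Hf Hn Hxy).
    unfold grad2 at 1.
    rewrite (grad_on_dx Om h _ _ x y Gh Hxy), (grad_on_dy Om h _ _ x y Gh Hxy).
    unfold r1, h, grad2; field; apply Hn, Hxy.
  + unfold W; rewrite dzbar_pair, dzbar_toC, Cmult_Cdiv_Cconj, Ex, Ey by (apply Hn, Hxy).
    rewrite (grad_on_dx Om h _ _ x y Gh Hxy), (grad_on_dy Om h _ _ x y Gh Hxy); unfold h.
    apply injective_projections; simpl; field; apply Hn, Hxy.
Qed.
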